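(* For every $g\ge2$ put $N=2g-1$ and take $N$ unit squares with darts $0,\dots,4N-1$, dart $4f+s$ being side $s$ of square $f$. (a) Gluing the pairs of darts $(0,2),\ (1,4),\ (3,5)$; $(s,s+2),\ (s+1,s+4),\ (s+3,s+6),\ (s+5,s+7)$ for $s=6+8b$, $b=0,\dots,g-3$ (no such pairs if $g=2$); $(t,t+2),\ (t+1,t+4),\ (t+3,t+5)$ with $t=4N-6$, gives a closed quad mesh of genus $g$ with a single vertex, of valence $8g-4$, and with $\operatorname{im}\rho=\mathbb{Z}_4$. (b) Gluing instead the pairs of darts $(0,2)$; $(2i-1,\,2i+2)$ for $i=1,\dots,2N-2$; $(4N-3,\,4N-1)$ gives, for the same $N$, a one-vertex closed quad mesh of genus $g$ with trivial holonomy ($\operatorname{im}\rho=0$): a translation surface in the minimal abelian stratum $\mathcal{H}(2g-2)$.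
   Context: Combinatorial model of a closed quad mesh (square-tiled oriented closed surface): it consists of unit squares $f=0,\dots,N-1$; its darts are the integers $4f+s$, $s\in\{0,1,2,3\}$, dart $4f+s$ being side $s$ of square $f$ traversed counterclockwise. The face rotation is $\sigma(4f+s)=4f+(s+1\bmod 4)$. The gluing is a fixed-point-free involution $\alpha$ on darts, given by listing its pairs (paired sides are identified with opposite orientations, so that the result is an oriented surface). The vertices are the orbits of $\nu=\alpha\circ\sigma^{-1}$, and the valence of a vertex is the length of its orbit. Holonomy: crossing from square $f$ through its side $s$, glued to side $t$ of square $h$, has rotation $r=(t-s+2)\bmod 4\in\mathbb{Z}_4=\mathbb{Z}/4\mathbb{Z}$. For a mesh with vertex set $V$, $\rho\colon H_1(M\setminus V;\mathbb{Z})\to\mathbb{Z}_4$ sends a cycle of the dual graph (nodes are squares, one dual edge per glued pair) to the sum of the rotations it crosses. $\mathcal{H}(2g-2)$ is the stratum of abelian differentials (holomorphic 1-forms) in genus $g$ with a single zero, of order $2g-2$. *)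

(* Defs.v *)
From HB Require Import structures.
From mathcomp Require Import all_boot all_order all_algebra.
From mathcomp Require Import complex.
From mathcomp Require Import all_classical all_reals all_analysis.
From Stdlib Require Import Relation_Operators.

Set Implicit Arguments.
Unset Strict Implicit.
Unset Printing Implicit Defensive.
Import Order.TTheory GRing.Theory Num.Theory.
Import numFieldNormedType.Exports.
Local Open Scope classical_set_scope.
Local Open Scope ring_scope.

(** * Quad meshes *)

(** The dart [4 * f + s] is the pair [(f, s)], so that side numbers are
    computed modulo 4. *)
Definition dart (N : nat) : finType := ('I_N * 'Z_4)%type.

Definition dart_num (N : nat) (d : dart N) : nat := (4 * d.1 + d.2)%N.

Record quad_mesh (N : nat) := QuadMesh {
  glue :> dart N -> dart N;
  glueK : involutive glue;
  glue_neq : forall d, glue d != d }.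

(** The gluing of [M] is given by the list [L] of pairs of integers: every dart
    occurs in exactly one pair of [L], and it is glued to its partner. This
    determines [M] up to extensionality. *)
Definition glued_by (L : seq (nat * nat)) (N : nat) (M : quad_mesh N) : Prop :=
  perm_eq (flatten [seq [:: p.1; p.2] | p <- L]) (iota 0 (4 * N)) /\
  forall d : dart N,
    (dart_num d, dart_num (M d)) \in L \/ (dart_num (M d), dart_num d) \in L.

Section Mesh.
Variables (N : nat) (M : quad_mesh N).

Definition face_rot (d : dart N) : dart N := (d.1, d.2 + 1).
Definition face_rot_inv (d : dart N) : dart N := (d.1, d.2 - 1).

Lemma face_rotK : cancel face_rot face_rot_inv.
Proof. by case=> f s; rewrite /face_rot /face_rot_inv /= addrK. Qed.

Lemma face_rot_invK : cancel face_rot_inv face_rot.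
Proof. by case=> f s; rewrite /face_rot /face_rot_inv /= subrK. Qed.

Definition vertex_perm (d : dart N) : dart N := M (face_rot_inv d).

Definition vertices : {set {set dart N}} :=
  [set [set e in orbit vertex_perm d] | d : dart N]%SET.

(** The valence of a vertex [v] is [#|v|]. *)

Definition edges : {set {set dart N}} :=
  [set [set d; M d]%SET | d : dart N]%SET.

Definition dual_adj : rel 'I_N :=
  [rel f h | [exists d : dart N, (d.1 == f) && ((M d).1 == h)]].

Definition mesh_connected : Prop := forall f h : 'I_N, connect dual_adj f h.

Definition mesh_euler : int := #|vertices|%:Z - #|edges|%:Z + N%:Z.

Definition mesh_genus (g : nat) : Prop :=
  mesh_connected /\ mesh_euler = 2 - 2 * g%:Z.

(** ** Holonomy *)

Definition rotation (d : dart N) : 'Z_4 := (M d).2 - d.2 + 2.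

(** The punctured surface retracts onto the dual graph, so its first homology
    is the group of integral 1-cycles of that graph. The value [c d] counts the
    crossings out of the square [d.1] through its side [d.2]; the dart [M d] is
    the same dual edge with the opposite orientation. *)
Definition dual_cycle (c : dart N -> int) : Prop :=
  (forall d, c (M d) = - c d) /\
  (forall f : 'I_N, \sum_(s : 'Z_4) c (f, s) = 0).

(** One summand per dual edge; since [rotation (M d) = - rotation d], the choice
    of the dart representing the edge is immaterial. *)
Definition holonomy (c : dart N -> int) : 'Z_4 :=
  \sum_(d : dart N | (dart_num d < dart_num (M d))%N) rotation d *~ c d.

Definition holonomy_image : set 'Z_4 := [set holonomy c | c in dual_cycle].

End Mesh.

(** * Compact Riemann surfaces and holomorphic 1-forms *)

(** The complex numbers over [R], packed so as to carry the topology of a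
    numerical field. In this topology [derivable f z 1] is complex
    differentiability at [z], and [f^`() z] is the complex derivative. *)
Definition Cplx (R : realType) : numClosedFieldType := R[i]%C.

Section Surfaces.
Variable R : realType.
Local Notation C := (Cplx R).

Record chart (X : topologicalType) := Chart {
  cdom : set X;
  ccod : set C;
  cmap : X -> C;
  cinv : C -> X;
  cdom_open : open cdom;
  ccod_open : open ccod;
  cmap_cod : forall x, cdom x -> ccod (cmap x);
  cinv_dom : forall z, ccod z -> cdom (cinv z);
  cmapK : forall x, cdom x -> cinv (cmap x) = x;
  cinvK : forall z, ccod z -> cmap (cinv z) = z;
  cmap_cont : forall x, cdom x -> {for x, continuous cmap};
  cinv_cont : forall z, ccod z -> {for z, continuous cinv} }.

(** The coordinate change from [a] to [b]; it is meaningful at those [z] in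
    [ccod a] for which [cinv a z] is in [cdom b]. *)
Definition transition (X : topologicalType) (a b : chart X) : C -> C :=
  cmap b \o cinv a.

Record compact_riemann_surface := CompactRiemannSurface {
  rs_space :> topologicalType;
  rs_index : Type;
  rs_chart : rs_index -> chart rs_space;
  rs_cover : forall x, exists i, cdom (rs_chart i) x;
  rs_holo : forall i j z,
    ccod (rs_chart i) z -> cdom (rs_chart j) (cinv (rs_chart i) z) ->
    derivable (transition (rs_chart i) (rs_chart j)) z 1;
  rs_hausdorff : hausdorff_space rs_space;
  rs_connected : connected [set: rs_space];
  rs_compact : compact [set: rs_space] }.

Arguments rs_chart : clear implicits.

(** A holomorphic 1-form, given by its expressions [form_coef i z] dz in the
    charts. *)
Record holomorphic_form (S : compact_riemann_surface) := HolomorphicForm {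
  form_coef : rs_index S -> C -> C;
  form_holo : forall i z, ccod (rs_chart S i) z -> derivable (form_coef i) z 1;
  form_compat : forall i j z,
    ccod (rs_chart S i) z -> cdom (rs_chart S j) (cinv (rs_chart S i) z) ->
    let T := transition (rs_chart S i) (rs_chart S j) in
    form_coef i z = form_coef j (T z) * T^`()%classic z }.

Section Forms.
Variables (S : compact_riemann_surface) (w : holomorphic_form S).

Definition vanishing_order (x : S) (k : nat) : Prop :=
  forall i, cdom (rs_chart S i) x ->
  let z0 := cmap (rs_chart S i) x in
  exists h : C -> C,
    [/\ h z0 != 0,
        \forall z \near z0, derivable h z 1 &
        \forall z \near z0, form_coef w i z = (z - z0) ^+ k * h z].

Definition single_zero_of_order (m : nat) : Prop :=
  exists x : S, vanishing_order x m /\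
    forall y : S, y <> x -> vanishing_order y 0.

End Forms.

(** * The surface of a mesh *)

Definition unit_square : set C :=
  [set z | (0 <= 'Re z <= 1) && (0 <= 'Im z <= 1)].

Definition open_unit_square : set C :=
  [set z | (0 < 'Re z < 1) && (0 < 'Im z < 1)].

(** Side [s] of the unit square at parameter [t] in [0, 1], counterclockwise:
    the bottom side [t] turned by [s] right angles about the centre. *)
Definition side_point (s : 'Z_4) (t : C) : C :=
  let ctr := (1 + 'i) / 2 in ctr + 'i ^+ s * (t - ctr).

Section Realization.
Variables (N : nat) (M : quad_mesh N).

Inductive side_glued : 'I_N * C -> 'I_N * C -> Prop :=
  SideGlued (d : dart N) (t : C) of 0 <= t <= 1 :
    side_glued (d.1, side_point d.2 t) ((M d).1, side_point (M d).2 (1 - t)).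

(** [q f z] is the image of the point [z] of the square [f]. The conditions say
    that [q] induces a continuous bijection, hence (compact to Hausdorff) a
    homeomorphism, from the space obtained by gluing the squares onto [S]. *)
Definition mesh_realization (S : compact_riemann_surface) (q : 'I_N -> C -> S)
    : Prop :=
  [/\ forall f, {within unit_square, continuous (q f)},
      forall x : S, exists f z, unit_square z /\ q f z = x &
      forall f h z z', unit_square z -> unit_square z' ->
        (q f z = q h z' <->
         clos_refl_sym_trans _ side_glued (f, z) (h, z'))].

(** In every square the form is dz up to a rotation by right angles, i.e., the
    squares are unit squares, with horizontal and vertical sides, of the
    translation structure defined by the form. *)
Definition squares_flat (S : compact_riemann_surface) (w : holomorphic_form S)
    (q : 'I_N -> C -> S) : Prop :=
  forall f : 'I_N, exists k : nat, forall z, open_unit_square z ->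
  forall i, cdom (rs_chart S i) (q f z) ->
  let phi := cmap (rs_chart S i) \o q f in
  derivable phi z 1 /\ form_coef w i (phi z) * phi^`()%classic z = 'i ^+ k.

(** The square-tiled surface of [M] is a translation surface in the stratum
    H(2g-2). *)
Definition in_minimal_stratum (g : nat) : Prop :=
  mesh_genus M g /\
  exists (S : compact_riemann_surface) (w : holomorphic_form S)
         (q : 'I_N -> C -> S),
    [/\ mesh_realization q, squares_flat w q &
        single_zero_of_order w (2 * g - 2)].

End Realization.
End Surfaces.

(** * The two gluings *)

Section Pairs.
Local Open Scope nat_scope.

Definition pairs_full (g : nat) : seq (nat * nat) :=
  let N := 2 * g - 1 in
  let t := 4 * N - 6 in
  [:: (0, 2); (1, 4); (3, 5)]
  ++ flatten [seq (let s := 6 + 8 * b in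
                   [:: (s, s + 2); (s + 1, s + 4); (s + 3, s + 6);
                       (s + 5, s + 7)]) | b <- iota 0 (g - 2)]
  ++ [:: (t, t + 2); (t + 1, t + 4); (t + 3, t + 5)].

Definition pairs_trivial (g : nat) : seq (nat * nat) :=
  let N := 2 * g - 1 in
  [:: (0, 2)]
  ++ [seq (2 * i - 1, 2 * i + 2) | i <- iota 1 (2 * N - 2)]
  ++ [:: (4 * N - 3, 4 * N - 1)].

End Pairs.

(* Main.v *)
Require Import Defs.
From HB Require Import structures.
From mathcomp Require Import all_boot all_order all_algebra.
From mathcomp Require Import complex zify ring lra.
From mathcomp Require Import all_classical all_reals all_analysis.
From Stdlib Require Import Relation_Operators.

Set Implicit Arguments.
Unset Strict Implicit.
Unset Printing Implicit Defensive.
Import Order.TTheory GRing.Theory Num.Theory.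
Import numFieldNormedType.Exports.

(** Both gluings join each square to the next one along two pairs of sides and
    close the chain of squares at its two ends. For such a mesh everything
    combinatorial reduces to a walk around the vertices: once the permutation of
    the darts around vertices is seen to have a single orbit ([stair_one_orbit],
    [twist_one_orbit]), there is one vertex of valence [4 * N], there are
    [2 * N] edges because the gluing is a fixed-point-free involution
    ([card_edges]), and the Euler characteristic is [1 - N = 2 - 2 * g].

    In (b), crossing from a square to the next one always turns by one right
    angle, so the rotation of a crossing is the difference of the values of a
    function on the squares, and it sums to zero over every cycle
    ([trivial_holonomy]). In (a), a loop through the first two squares turns by
    a single right angle, and its multiples reach all of [Z_4]
    ([twist_holonomy]).

    The remaining part of (b) is that a one-vertex mesh with trivial holonomy is
    a translation surface with a single zero ([translation_surface]). The surface
    is the quotient of the closed squares with the final topology, in which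
    openness and continuity are tested square by square. Rotating square [f] by
    [square_dir f] makes all gluings translations, so that locally the surface
    has a developing map to the plane. Three families of charts are used: discs
    around the centres of the squares and around the midpoints of the edges, on
    which the developing map itself is the coordinate, and one disc around the
    vertex. There [4 * N] quarter discs fit together to a cone of angle
    [2 * pi * N], and the coordinate is the [N]-th root of the developing map
    ([root_petal]).

    All these are instances of one notion, [petal_chart]: finitely many pieces of
    discs, called petals, with a common coordinate [w] such that [w ^ m] is a
    developing map. Everything analytic is derived for this notion. The
    developing maps of two charts differ by a locally constant function
    ([developing_locally_constant]); hence a coordinate change [T] satisfies
    [T ^ m' = w ^ m + c], and a continuous root of a holomorphic function is
    holomorphic away from the branch point ([derivable_root]). Differentiating
    this equation also shows that the forms [m * w ^ (m - 1) dw] agree on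
    overlaps. The form is [dz] up to a rotation in each square, and its only zero
    is at the vertex, of order [N - 1 = 2 * g - 2]. *)

Local Open Scope classical_set_scope.
Local Open Scope ring_scope.

(** * Meshes given by an involution of the dart numbers *)

Section DartNumbers.
Variable N : nat.
Local Open Scope nat_scope.

Lemma side_lt4 (s : 'Z_4) : s < 4.
Proof. exact: ltn_ord s. Qed.

Lemma dart_num_lt (d : dart N) : dart_num d < 4 * N.
Proof.
case: d => f s; rewrite /dart_num /=.
have := ltn_ord f; have := side_lt4 s; lia.
Qed.

Lemma dart_num_inj : injective (@dart_num N).
Proof.
move=> [f s] [h t]; rewrite /dart_num /= => E.
have := side_lt4 s; have := side_lt4 t => ht hs.
congr pair; apply: val_inj => /=; lia.
Qed.

Lemma square_lt n : n < 4 * N -> n %/ 4 < N.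
Proof. lia. Qed.

Definition dart_of n (h : n < 4 * N) : dart N :=
  (Ordinal (square_lt h), inZp n : 'Z_4).

Lemma dart_ofK n (h : n < 4 * N) : dart_num (dart_of h) = n.
Proof. rewrite /dart_num /=; lia. Qed.

(** The inverse face rotation on dart numbers. *)
Definition prev_num n := if n %% 4 == 0 then n + 3 else n - 1.

Lemma dart_num_face_rot_inv (d : dart N) :
  dart_num (face_rot_inv d) = prev_num (dart_num d).
Proof.
have E : nat_of_ord (d.2 - 1)%R = ((d.2 + 3) %% 4)%N.
  by case: (d.2) => [[|[|[|[|]]]]].
rewrite /dart_num /prev_num [nat_of_ord (face_rot_inv d).2]E.
have := side_lt4 d.2; case: ifP => /=; lia.
Qed.

Section MeshOfInvolution.
Variable a : nat -> nat.
Hypothesis a_lt : forall n, n < 4 * N -> a n < 4 * N.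
Hypothesis aK : forall n, n < 4 * N -> a (a n) = n.
Hypothesis a_neq : forall n, n < 4 * N -> a n != n.

Definition num_glue (d : dart N) : dart N := dart_of (a_lt (dart_num_lt d)).

Lemma num_glueE d : dart_num (num_glue d) = a (dart_num d).
Proof. by rewrite dart_ofK. Qed.

Lemma num_glueK : involutive num_glue.
Proof. by move=> d; apply: dart_num_inj; rewrite !num_glueE aK ?dart_num_lt. Qed.

Lemma num_glue_neq d : num_glue d != d.
Proof.
apply/negP => /eqP /(congr1 (@dart_num N)) /eqP; rewrite num_glueE.
by apply/negP; rewrite a_neq ?dart_num_lt.
Qed.

Definition num_mesh := QuadMesh num_glueK num_glue_neq.

Lemma num_mesh_vertex_perm d :
  dart_num (vertex_perm num_mesh d) = a (prev_num (dart_num d)).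
Proof. by rewrite /vertex_perm /= num_glueE dart_num_face_rot_inv. Qed.

End MeshOfInvolution.
End DartNumbers.

(** * Meshes with one vertex *)

Section MeshCombinatorics.
Variables (N : nat) (M : quad_mesh N).

Lemma face_rot_inv_inj : injective (@face_rot_inv N).
Proof. exact: can_inj (@face_rot_invK N). Qed.

Lemma vertex_perm_inj : injective (vertex_perm M).
Proof. by move=> d e /(can_inj (glueK M)) /face_rot_inv_inj. Qed.

Lemma card_dart : #|dart N| = (4 * N)%N.
Proof. by rewrite card_prod !card_ord mulnC. Qed.

(** The edges partition the darts into pairs. *)
Lemma card_edges : (2 * #|edges M| = 4 * N)%N.
Proof.
pose D := [set: dart N]%SET.
have part : finset.partition (edges M) D.
  apply/and3P; split.
  - rewrite finset.eqEsubset finset.subsetT /=; apply/fintype.subsetP => d _.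
    apply/finset.bigcupP; exists [set d; M d]%SET; last by rewrite !inE eqxx.
    by apply/imsetP; exists d.
  - apply/finset.trivIsetP => A B /imsetP[d _ ->] /imsetP[e _ ->] nAB.
    rewrite -setI_eq0; apply/negPn/negP => /set0Pn[x].
    rewrite !inE => /andP[/orP[]/eqP-> /orP[]/eqP E]; case/eqP: nAB.
    + by rewrite E.
    + by rewrite E glueK finset.setUC.
    + by rewrite -E glueK finset.setUC.
    + by rewrite (can_inj (glueK M) E).
  - apply/negP => /imsetP[d _] /setP /(_ d).
    by rewrite !inE eqxx.
have := card_uniform_partition (n := 2) _ part.
rewrite /D cardsT card_dart => -> ; first by rewrite mulnC.
move=> A /imsetP[d _ ->]; rewrite cards2.
by rewrite eq_sym glue_neq.
Qed.

Hypothesis one_orbit : forall d e, fconnect (vertex_perm M) d e.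

Lemma orbit_setT d :
  [set e in orbit (vertex_perm M) d]%SET = [set: dart N]%SET.
Proof. by apply/setP => e; rewrite !inE -fconnect_orbit one_orbit. Qed.

Lemma one_vertex (d : dart N) : vertices M = [set [set: dart N]]%SET.
Proof.
apply/setP => v; rewrite inE; apply/imsetP/eqP => [[e _ ->]|->].
  exact: orbit_setT.
by exists d; rewrite ?inE // orbit_setT.
Qed.

Lemma one_vertex_euler (d : dart N) : mesh_euler M = 1 - N%:Z.
Proof.
have E := card_edges.
rewrite /mesh_euler (one_vertex d) cards1; lia.
Qed.

End MeshCombinatorics.

Lemma connected_path N (M : quad_mesh N) :
  (forall f h : 'I_N, h = f.+1 :> nat -> dual_adj M f h) ->
  mesh_connected M.
Proof.
case: N M => [M _ []//|n M H].
have sym : connect_sym (dual_adj M).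
  apply: sym_connect_sym => f h; apply/existsP/existsP => -[d /andP[/eqP<- /eqP<-]];
  by exists (M d); rewrite glueK !eqxx.
have C0 : forall k (h : 'I_n.+1), nat_of_ord h = k -> connect (dual_adj M) ord0 h.
  elim=> [|k IH] h hk.
    by have -> : h = ord0 by apply: val_inj.
  have kn : (k < n.+1)%N by rewrite ltnW // -hk.
  apply: connect_trans (IH (Ordinal kn) erefl) (connect1 _).
  exact: H.
move=> f h; apply: connect_trans (C0 _ h erefl).
by rewrite sym; apply: C0.
Qed.

(** * Holonomy given by a potential *)
Lemma sum_dart N (V : zmodType) (F : dart N -> V) :
  \sum_(d : dart N) F d = \sum_(f : 'I_N) \sum_(s : 'Z_4) F (f, s).
Proof.
rewrite (pair_bigA _ (fun f (s : 'Z_4) => F (f, s))) /=.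
by apply: eq_bigr => -[].
Qed.

(** Summation by parts: moving the half of the sum at [M d] to the other dart of
    the edge turns it into a sum over all darts, where each square contributes
    [th f] times the total flow out of [f], which vanishes on a cycle. *)
Lemma potential_sum0 N (M : quad_mesh N) (V : zmodType) (th : 'I_N -> V) c :
  dual_cycle M c ->
  \sum_(d : dart N | (dart_num d < dart_num (M d))%N)
     (th (M d).1 - th d.1) *~ c d = 0.
Proof.
move=> [anti closed].
have S0 : \sum_(d : dart N) th d.1 *~ c d = 0.
  rewrite sum_dart big1 // => f _.
  by rewrite /= -mulrz_sumr closed mulr0z.
have := S0; rewrite (bigID (fun d => (dart_num d < dart_num (M d))%N)) /=.
rewrite [X in _ + X](reindex_inj (can_inj (glueK M))) /=.
rewrite [X in _ + X](eq_bigl (fun d => (dart_num d < dart_num (M d))%N)); last first.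
  move=> d; rewrite glueK -leqNgt leq_eqVlt.
  have : dart_num d <> dart_num (M d).
    by move/dart_num_inj/esym/eqP; apply/negP/glue_neq.
  by move/eqP/negPf => ->.
rewrite -big_split /= => E.
apply: oppr_inj; rewrite oppr0 -[RHS]E -sumrN; apply: eq_bigr => d _.
by rewrite anti mulrNz mulrzBl opprB.
Qed.

Lemma trivial_holonomy N (M : quad_mesh N) (th : 'I_N -> 'Z_4) :
  (forall d, rotation M d = th (M d).1 - th d.1) ->
  holonomy_image M = [set 0].
Proof.
move=> H; apply/seteqP; split=> [r [c cyc <-]|r ->] /=; last first.
  exists (fun=> 0).
    by split=> [d|f]; rewrite ?oppr0 // big1.
  by rewrite /holonomy big1 // => d _; rewrite mulr0z.
rewrite /holonomy -[RHS](potential_sum0 th cyc).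
by apply: eq_bigr => d _; rewrite H.
Qed.

(** * Gluings given by a list of pairs *)
Lemma size_flatten_pairs (L : seq (nat * nat)) :
  size (flatten [seq [:: p.1; p.2] | p <- L]) = (2 * size L)%N.
Proof. by elim: L => //= p L ->; rewrite mulnS. Qed.

(** A list of [2 * N] pairs has [4 * N] entries, so as soon as every dart number
    occurs in it, each occurs exactly once. *)
Lemma num_mesh_glued (L : seq (nat * nat)) N a a_lt aK a_neq :
  size L = (2 * N)%N ->
  (forall n, (n < 4 * N)%N -> (n, a n) \in L \/ (a n, n) \in L) ->
  glued_by L (@num_mesh N a a_lt aK a_neq).
Proof.
move=> szL inL; split; last first.
  by move=> d; rewrite num_glueE; apply: inL; apply: dart_num_lt.
have sub : {subset iota 0 (4 * N) <= flatten [seq [:: p.1; p.2] | p <- L]}.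
  move=> n; rewrite mem_iota add0n /= => /inL[]H; apply/flattenP.
    by exists [:: n; a n]; [apply/mapP; exists (n, a n) | rewrite inE eqxx].
  by exists [:: a n; n]; [apply/mapP; exists (a n, n) | rewrite !inE eqxx orbT].
have sz : (size (flatten [seq [:: p.1; p.2] | p <- L]) <= size (iota 0 (4 * N)))%N.
  by rewrite size_flatten_pairs szL size_iota; lia.
have [_ E] := uniq_min_size (iota_uniq _ _) sub sz.
rewrite perm_sym; apply: uniq_perm => //; first exact: iota_uniq.
exact: leq_size_uniq (iota_uniq _ _) sub sz.
Qed.

Section OneOrbit.
Variables (N : nat) (a : nat -> nat).
Hypothesis a_lt : forall n, (n < 4 * N)%N -> (a n < 4 * N)%N.
Hypothesis aK : forall n, (n < 4 * N)%N -> a (a n) = n.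
Hypothesis a_neq : forall n, (n < 4 * N)%N -> a n != n.
Let M := num_mesh a_lt aK a_neq.

(** The permutation around the vertices is transitive iff a property of dart
    numbers that is invariant under it, in both directions, is universal as soon
    as it holds at [0]; in this form the orbit can be explored by induction on
    the squares. *)
Lemma num_mesh_one_orbit :
  (forall P : nat -> Prop, P 0%N ->
     (forall n, (n < 4 * N)%N -> P n <-> P (a (prev_num n))) ->
     forall n, (n < 4 * N)%N -> P n) ->
  forall d e, fconnect (vertex_perm M) d e.
Proof.
move=> H.
pose P n := forall d e : dart N, dart_num d = 0%N -> dart_num e = n ->
  fconnect (vertex_perm M) d e.
have sym := fconnect_sym (@vertex_perm_inj _ M).
have HP : forall n, (n < 4 * N)%N -> P n.
  apply: H => [d e d0 e0|n nN].
    by have -> : d = e by apply: dart_num_inj; rewrite d0.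
  have E d : dart_num d = n -> dart_num (vertex_perm M d) = a (prev_num n).
    by move=> <-; rewrite num_mesh_vertex_perm.
  split=> Pn d e d0 en.
    have := Pn d (dart_of nN) d0 (dart_ofK nN).
    have -> : e = vertex_perm M (dart_of nN).
      by apply: dart_num_inj; rewrite E ?dart_ofK.
    by move=> /connect_trans; apply; apply: fconnect1.
  have := Pn d (vertex_perm M e) d0 (E _ en).
  by move=> /connect_trans; apply; rewrite sym; apply: fconnect1.
move=> d e; have N0 : (0 < 4 * N)%N by apply: leq_ltn_trans (dart_num_lt d).
have Hd x := HP _ (dart_num_lt x) (dart_of N0) x (dart_ofK N0) erefl.
by apply: connect_trans (Hd e); rewrite sym.
Qed.
End OneOrbit.

Lemma dart_num_square N (d : dart N) : (dart_num d %/ 4)%N = d.1.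
Proof. by case: d => f s; rewrite /dart_num /=; have := side_lt4 s; lia. Qed.

Lemma dart_num_side N (d : dart N) : d.2 = (dart_num d)%:R.
Proof.
rewrite Zp_nat; apply: val_inj => /=.
case: d => f s; have hs := side_lt4 s.
rewrite [RHS](_ : _ = (4 * f + s) %% 4)%N //=; lia.
Qed.

Lemma num_mesh_connected N a a_lt aK a_neq :
  (forall f, (f.+1 < N)%N -> exists n, [/\ (n < 4 * N)%N,
     (n %/ 4 = f)%N & (a n %/ 4 = f.+1)%N]) ->
  mesh_connected (@num_mesh N a a_lt aK a_neq).
Proof.
move=> H; apply: connected_path => f h hf.
have [|n [nN nf nh]] := H f; first by rewrite -hf.
apply/existsP; exists (dart_of nN); apply/andP; split; apply/eqP/val_inj.
  by apply: etrans (esym (dart_num_square _)) _; rewrite dart_ofK.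
by apply: etrans (esym (dart_num_square _)) _; rewrite num_glueE dart_ofK nh -hf.
Qed.

Lemma one_vertex_genus g (M : quad_mesh (2 * g - 1)) (d : dart (2 * g - 1)) :
  mesh_connected M -> (forall d e, fconnect (vertex_perm M) d e) ->
  mesh_genus M g.
Proof.
move=> con orb; split=> //; rewrite (one_vertex_euler orb d).
have := ltn_ord d.1; lia.
Qed.

(** * The staircase gluing *)

Section Staircase.
Variable g : nat.
Hypothesis hg : (2 <= g)%N.
Let N := (2 * g - 1)%N.
Local Open Scope nat_scope.

(** Sides [1] and [3] of a square are glued to sides [0] and [2] of the next one,
    which is [n + 3] for the dart number [n]; the special cases glue the free
    sides of the first and of the last square. *)
Definition stair_num n :=
  if n == 0 then 2 else if n == 2 then 0
  else if n == 4 * (2 * g - 1) - 3 then 4 * (2 * g - 1) - 1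
  else if n == 4 * (2 * g - 1) - 1 then 4 * (2 * g - 1) - 3
  else if n %% 2 == 1 then n + 3 else n - 3.

Lemma stair_num_lt n : n < 4 * N -> stair_num n < 4 * N.
Proof. by rewrite /N /stair_num => h; repeat case: ifP => ?; lia. Qed.

Lemma stair_numK n : n < 4 * N -> stair_num (stair_num n) = n.
Proof.
rewrite /N => h; rewrite [in X in stair_num X]/stair_num.
repeat case: ifP => ?; rewrite /stair_num; repeat case: ifP => ?; rewrite /=; lia.
Qed.

Lemma stair_num_neq n : n < 4 * N -> stair_num n != n.
Proof. by rewrite /N /stair_num => h; repeat case: ifP => ?; lia. Qed.

Definition stair_mesh : quad_mesh (2 * g - 1) :=
  num_mesh stair_num_lt stair_numK stair_num_neq.

Lemma stair_glued : glued_by (pairs_trivial g) stair_mesh.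
Proof.
apply: num_mesh_glued => [|n nN].
  by rewrite /pairs_trivial !size_cat size_map size_iota /=; lia.
rewrite /pairs_trivial !mem_cat.
have I m : m < 4 * (2 * g - 1) - 3 -> m %% 2 = 1 ->
    (m, m + 3) \in [seq (2 * i - 1, 2 * i + 2) | i <- iota 1 (2 * (2 * g - 1) - 2)].
  move=> h1 h2; apply/mapP; exists ((m + 1) %/ 2); first by rewrite mem_iota; lia.
  congr pair; lia.
rewrite /stair_num; repeat (case: ifP => [/eqP ?|/eqP ?]).
- by left; subst n.
- by right; subst n.
- by left; subst n; rewrite !inE eqxx !orbT.
- by right; subst n; rewrite !inE eqxx !orbT.
- by left; rewrite I ?orbT; lia.
- right; have := I (n - 3); have -> : n - 3 + 3 = n by lia.
  by move=> ->; rewrite ?orbT //; lia.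
Qed.

(** Around the vertex, side [1] is followed by side [1] of the previous square,
    and likewise for side [3]; sides [2] and [0] are followed by sides [0] and
    [2] of the next square. These four chains are linked through the first and
    the last square, and since the number of squares is odd they form a single
    orbit. *)
Lemma stair_num_orbit (P : nat -> Prop) : P 0 ->
  (forall n, n < 4 * N -> P n <-> P (stair_num (prev_num n))) ->
  forall n, n < 4 * N -> P n.
Proof.
rewrite /N => P0 step.
have st n m : n < 4 * (2 * g - 1) -> stair_num (prev_num n) = m -> P n <-> P m.
  by move=> h <-; apply: step.
have H1 f : f < 2 * g - 1 -> P (4 * f + 1) <-> P 1.
  elim: f => [|f IH] fN; first by rewrite muln0.
  rewrite -IH; last by lia.
  apply: st; first lia.
  by rewrite /prev_num; case: ifP => ?; rewrite /stair_num; repeat case: ifP => ?; lia.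
have H3 f : f < 2 * g - 1 -> P (4 * f + 3) <-> P 3.
  elim: f => [|f IH] fN; first by rewrite muln0.
  rewrite -IH; last by lia.
  apply: st; first lia.
  by rewrite /prev_num; case: ifP => ?; rewrite /stair_num; repeat case: ifP => ?; lia.
have H02 f : f < 2 * g - 1 ->
   (P (4 * f + 2) <-> P (if f %% 2 == 0 then 2 else 0)) /\
   (P (4 * f) <-> P (if f %% 2 == 0 then 0 else 2)).
  elim: f => [|f IH] fN; first by rewrite muln0.
  have [|I2 I0] := IH; first lia.
  have S2 : P (4 * f + 2) <-> P (4 * f.+1).
    apply: st; first lia.
    by rewrite /prev_num; case: ifP => ?; rewrite /stair_num; repeat case: ifP => ?; lia.
  have S0 : P (4 * f) <-> P (4 * f.+1 + 2).
    apply: st; first lia.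
    by rewrite /prev_num; case: ifP => ?; rewrite /stair_num; repeat case: ifP => ?; lia.
  rewrite -S2 -S0 I2 I0.
  have [h|h] : f %% 2 = 0 \/ f %% 2 = 1 by lia.
    have h' : f.+1 %% 2 = 1 by lia.
    by rewrite h h'.
  have h' : f.+1 %% 2 = 0 by lia.
  by rewrite h h'.
have E12 : P 1 <-> P 2.
  by apply: st; [lia | rewrite /prev_num /stair_num /=; repeat case: ifP => ?; lia].
have E30 : P 3 <-> P 0.
  by apply: st; [lia | rewrite /prev_num /stair_num /=; repeat case: ifP => ?; lia].
have E23 : P 2 <-> P 3.
  have [|I2 _] := H02 (2 * g - 2); first lia.
  rewrite -(H3 (2 * g - 2)); last lia.
  have h : (2 * g - 2) %% 2 = 0 by lia.
  rewrite h /= in I2; rewrite -I2.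
  by apply: st; [lia | rewrite /prev_num; case: ifP => ?; rewrite /stair_num; repeat case: ifP => ?; lia].
have P3 : P 3 by rewrite E30.
have P2 : P 2 by rewrite E23.
have P1 : P 1 by rewrite E12.
move=> n nN.
have fN : n %/ 4 < 2 * g - 1 by lia.
have [I2 I0] := H02 _ fN.
have [h|[h|[h|h]]] : n %% 4 = 0 \/ n %% 4 = 1 \/ n %% 4 = 2 \/ n %% 4 = 3 by lia.
- have -> : n = 4 * (n %/ 4) by lia.
  by rewrite I0; case: ifP.
- have -> : n = 4 * (n %/ 4) + 1 by lia.
  by rewrite H1.
- have -> : n = 4 * (n %/ 4) + 2 by lia.
  by rewrite I2; case: ifP.
- have -> : n = 4 * (n %/ 4) + 3 by lia.
  by rewrite H3.
Qed.

Lemma stair_one_orbit d e : fconnect (vertex_perm stair_mesh) d e.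
Proof. by apply: num_mesh_one_orbit; apply: stair_num_orbit. Qed.

Lemma stair_connected : mesh_connected stair_mesh.
Proof.
apply: num_mesh_connected => f fN; exists (4 * f + 1); split; try lia.
by rewrite /stair_num; repeat case: ifP => ?; lia.
Qed.

(** The number of right angles by which a square is turned in the translation
    structure. *)
Definition stair_turn (f : 'I_(2 * g - 1)) : 'Z_4 := (nat_of_ord f)%:R%R.

Lemma stair_rotation d :
  rotation stair_mesh d = (stair_turn (stair_mesh d).1 - stair_turn d.1)%R.
Proof.
rewrite /rotation /stair_turn !dart_num_side -!dart_num_square !num_glueE.
have nN := dart_num_lt d; set n := dart_num d in nN *.
have shuffle (V : zmodType) (h k r s t : V) :
    (t + r + k = h + s -> t - s + r = h - k)%R.
  move=> /(canRL (addrK k))/(canRL (addrK r)) ->.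
  by rewrite addrAC subrK addrAC addrK.
apply: shuffle; rewrite -(natrD _ _ 2) -!natrD !Zp_nat; apply: val_inj.
rewrite [LHS](_ : _ = (stair_num n + 2 + n %/ 4) %% 4) //.
rewrite [RHS](_ : _ = (stair_num n %/ 4 + n) %% 4) //.
by rewrite /stair_num; repeat case: ifP => ?; lia.
Qed.

End Staircase.

(** * The gluing with full holonomy *)

Section Twisted.
Variable g : nat.
Hypothesis hg : (2 <= g)%N.
Let N := (2 * g - 1)%N.
Local Open Scope nat_scope.

(** Two consecutive squares are a period of the gluing, so that the partner of a
    dart depends on its number modulo 8, except for the pairs of free sides of
    the first and the last square. *)
Definition twist_num n :=
  if n == 0 then 2 else if n == 2 then 0
  else if n == 4 * (2 * g - 1) - 3 then 4 * (2 * g - 1) - 1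
  else if n == 4 * (2 * g - 1) - 1 then 4 * (2 * g - 1) - 3
  else nth 0 [:: n - 2; n + 3; n - 3; n + 2; n - 3; n - 2; n + 2; n + 3] (n %% 8).

Variant twist_spec n : nat -> Prop :=
| TwistFirst0 of n = 0 : twist_spec n 2
| TwistFirst2 of n = 2 : twist_spec n 0
| TwistLast1 of n = 4 * N - 3 : twist_spec n (4 * N - 1)
| TwistLast3 of n = 4 * N - 1 : twist_spec n (4 * N - 3)
| Twist1 of n %% 8 = 1 & n < 4 * N - 3 : twist_spec n (n + 3)
| Twist3 of n %% 8 = 3 & n < 4 * N - 3 : twist_spec n (n + 2)
| Twist6 of n %% 8 = 6 & n < 4 * N - 3 : twist_spec n (n + 2)
| Twist7 of n %% 8 = 7 & n < 4 * N - 3 : twist_spec n (n + 3)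
| Twist4 of n %% 8 = 4 & 2 < n : twist_spec n (n - 3)
| Twist5 of n %% 8 = 5 & 2 < n : twist_spec n (n - 2)
| Twist0 of n %% 8 = 0 & 2 < n : twist_spec n (n - 2)
| Twist2 of n %% 8 = 2 & 2 < n : twist_spec n (n - 3).

Lemma twistP n : n < 4 * N -> twist_spec n (twist_num n).
Proof.
rewrite /twist_num => h.
case: eqP => [->|n0]; first exact: TwistFirst0.
case: eqP => [->|n2]; first exact: TwistFirst2.
case: eqP => [->|n3]; first exact: TwistLast1.
case: eqP => [->|n1]; first exact: TwistLast3.
have : n %% 8 < 8 by lia.
move: (erefl (n %% 8)); case: {2 3 4}(n %% 8) => [|[|[|[|[|[|[|[|//]]]]]]]] E _ /=.
all: by constructor; move: h; rewrite ?/N; lia.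
Qed.

Lemma twist_num_lt n : n < 4 * N -> twist_num n < 4 * N.
Proof. by move=> h; case: twistP => //; move: h; rewrite /N; lia. Qed.

Lemma twist_numK n : n < 4 * N -> twist_num (twist_num n) = n.
Proof.
move=> h; have := twist_num_lt h; case: (twistP h) => [?|?|?|?|??|??|??|??|??|??|??|??] h'.
all: by case: (twistP h'); rewrite /N in h h' *; lia.
Qed.

Lemma twist_num_neq n : n < 4 * N -> twist_num n != n.
Proof. by move=> h; case: twistP => //; move: h; rewrite /N; lia. Qed.

Definition twist_mesh : quad_mesh (2 * g - 1) :=
  num_mesh twist_num_lt twist_numK twist_num_neq.

Lemma twist_glued : glued_by (pairs_full g) twist_mesh.
Proof.
apply: num_mesh_glued => [|n nN].
  have sz F s : (forall b : nat, size (F b) = 4) ->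
      size (flatten [seq F b | b <- s] : seq (nat * nat)) = 4 * size s.
    by move=> F4; elim: s => //= b s IH; rewrite size_cat F4 IH mulnS.
  by rewrite /pairs_full !size_cat sz // size_iota /=; lia.
have blk b p : b < g - 2 -> let s := 6 + 8 * b in
    p \in [:: (s, s + 2); (s + 1, s + 4); (s + 3, s + 6); (s + 5, s + 7)] ->
    p \in pairs_full g.
  move=> hb s hp; rewrite /pairs_full !mem_cat; apply/orP; right; apply/orP; left.
  by apply/flatten_mapP; exists b; rewrite ?mem_iota.
have hd p : p \in [:: (0, 2); (1, 4); (3, 5)] -> p \in pairs_full g.
  by rewrite /pairs_full mem_cat => ->.
have tl p : let t := 4 * (2 * g - 1) - 6 in
    p \in [:: (t, t + 2); (t + 1, t + 4); (t + 3, t + 5)] -> p \in pairs_full g.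
  by move=> t hp; rewrite /pairs_full !mem_cat hp !orbT.
have J1 m : m %% 8 = 1 -> m < 4 * N - 3 -> (m, m + 3) \in pairs_full g.
  rewrite /N => h1 h2; have [->|m1] := eqVneq m 1; first by apply: hd.
  apply: (blk ((m - 9) %/ 8)); first lia.
  by rewrite !inE !xpair_eqE; lia.
have J3 m : m %% 8 = 3 -> m < 4 * N - 3 -> (m, m + 2) \in pairs_full g.
  rewrite /N => h1 h2; have [->|m1] := eqVneq m 3; first by apply: hd.
  apply: (blk ((m - 11) %/ 8)); first lia.
  by rewrite !inE !xpair_eqE; lia.
have J6 m : m %% 8 = 6 -> m < 4 * N - 3 -> (m, m + 2) \in pairs_full g.
  rewrite /N => h1 h2; have [m1|m1] := eqVneq m (4 * (2 * g - 1) - 6).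
    by apply: tl; rewrite !inE !xpair_eqE; lia.
  apply: (blk ((m - 6) %/ 8)); first lia.
  by rewrite !inE !xpair_eqE; lia.
have J7 m : m %% 8 = 7 -> m < 4 * N - 3 -> (m, m + 3) \in pairs_full g.
  rewrite /N => h1 h2; have [m1|m1] := eqVneq m (4 * (2 * g - 1) - 5).
    by apply: tl; rewrite !inE !xpair_eqE; lia.
  apply: (blk ((m - 7) %/ 8)); first lia.
  by rewrite !inE !xpair_eqE; lia.
have back k m (e : m = k + (m - k)) : (m - k, m) = (m - k, m - k + k).
  by congr pair; lia.
case: (twistP nN) => [->|->|->|->|h l|h l|h l|h l|h l|h l|h l|h l].
- by left; apply: hd.
- by right; apply: hd.
- by left; apply: tl; rewrite !inE !xpair_eqE /N; lia.
- by right; apply: tl; rewrite !inE !xpair_eqE /N; lia.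
- by left; apply: J1.
- by left; apply: J3.
- by left; apply: J6.
- by left; apply: J7.
- by right; rewrite back; [apply: J1|]; lia.
- by right; rewrite back; [apply: J3|]; lia.
- by right; rewrite back; [apply: J6|]; lia.
- by right; rewrite back; [apply: J7|]; lia.
Qed.

(** Around the vertex, [8 * j + 2] and [8 * j + 4] form one ascending chain. The
    other darts form one descending chain with steps
    [8 * j], [8 * j + 5], [8 * j + 1], [8 * j - 2], [8 * j - 5], [8 * j - 9] and
    [8 * j - 8]; it turns into the ascending one at dart [1]. *)
Lemma twist_num_orbit (P : nat -> Prop) : P 0 ->
  (forall n, n < 4 * N -> P n <-> P (twist_num (prev_num n))) ->
  forall n, n < 4 * N -> P n.
Proof.
move=> P0 step.
have st n m : n < 4 * (2 * g - 1) ->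
    (forall k, k < 4 * (2 * g - 1) -> k = prev_num n ->
       twist_spec k (twist_num k) -> twist_num k = m) -> P n <-> P m.
  move=> h H; have kN : prev_num n < 4 * (2 * g - 1).
    by rewrite /prev_num; case: ifP; lia.
  by rewrite -(H _ kN erefl (twistP kN)); apply: step.
have Ea j : 8 * j < 4 * (2 * g - 1) -> P (8 * j) <-> P (8 * j + 1).
  move=> h; have [h5|h5] := leqP (4 * (2 * g - 1)) (8 * j + 5).
    by apply: st => [|k kN -> []]; rewrite /prev_num /N; try case: ifP; lia.
  transitivity (P (8 * j + 5)).
    by apply: st => [|k kN -> []]; rewrite /prev_num /N; try case: ifP; lia.
  by apply: st => [|k kN -> []]; rewrite /prev_num /N; try case: ifP; lia.
have E5 j : 8 * j + 5 < 4 * (2 * g - 1) -> P (8 * j + 5) <-> P (8 * j + 1).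
  by move=> h; apply: st => [|k kN -> []]; rewrite /prev_num /N; try case: ifP; lia.
have E9 j : 8 * j + 9 < 4 * (2 * g - 1) -> P (8 * j + 9) <-> P (8 * j + 6).
  by move=> h; apply: st => [|k kN -> []]; rewrite /prev_num /N; try case: ifP; lia.
have E6 j : 8 * j + 6 < 4 * (2 * g - 1) -> P (8 * j + 6) <-> P (8 * j + 3).
  by move=> h; apply: st => [|k kN -> []]; rewrite /prev_num /N; try case: ifP; lia.
have E11 j : 8 * j + 11 < 4 * (2 * g - 1) -> P (8 * j + 11) <-> P (8 * j + 7).
  by move=> h; apply: st => [|k kN -> []]; rewrite /prev_num /N; try case: ifP; lia.
have E7 j : 8 * j + 7 < 4 * (2 * g - 1) -> P (8 * j + 7) <-> P (8 * j.+1).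
  by move=> h; apply: st => [|k kN -> []]; rewrite /prev_num /N; try case: ifP; lia.
have E2 j : 8 * j + 4 < 4 * (2 * g - 1) -> P (8 * j + 2) <-> P (8 * j + 4).
  by move=> h; apply: st => [|k kN -> []]; rewrite /prev_num /N; try case: ifP; lia.
have E4 j : 8 * j + 4 < 4 * (2 * g - 1) -> P (8 * j + 4) <-> P (8 * j + 10).
  by move=> h; apply: st => [|k kN -> []]; rewrite /prev_num /N; try case: ifP; lia.
have E3 : P 3 <-> P 0.
  by apply: st => [|k kN -> []]; rewrite /prev_num /N /=; lia.
have E1 : P 1 <-> P 2.
  by apply: st => [|k kN -> []]; rewrite /prev_num /N /=; lia.
have PA j : 8 * j + 3 < 4 * (2 * g - 1) ->
    [/\ P (8 * j), P (8 * j + 1) & P (8 * j + 3)].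
  elim: j => [|j IH] h.
    by split; [rewrite muln0 | rewrite -Ea ?muln0 //; lia | rewrite muln0 E3].
  have [|Q0 Q1 Q3] := IH; first lia.
  have R9 : P (8 * j.+1 + 1).
    have -> : 8 * j.+1 + 1 = 8 * j + 9 by lia.
    by rewrite E9 ?E6 //; lia.
  have R8 : P (8 * j.+1) by rewrite Ea //; lia.
  split=> //.
  have -> : 8 * j.+1 + 3 = 8 * j + 11 by lia.
  by rewrite E11; [rewrite E7 //|]; lia.
have PB j : 8 * j + 2 < 4 * (2 * g - 1) -> P (8 * j + 2).
  elim: j => [|j IH] h; first by rewrite -E1 -[1]/(8 * 0 + 1) -Ea //; lia.
  have -> : 8 * j.+1 + 2 = 8 * j + 10 by lia.
  by rewrite -E4; [rewrite -E2; [apply: IH|]|]; lia.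
move=> n nN; have E : n = 8 * (n %/ 8) + n %% 8 by lia.
have : n %% 8 < 8 by lia.
move: (n %/ 8) (n %% 8) E => q r E rlt.
have [Q0 Q1 Q3] : [/\ P (8 * q), P (8 * q + 1) & P (8 * q + 3)].
  by apply: PA; move: nN; rewrite /N; lia.
rewrite E; case: r E rlt => [|[|[|[|[|[|[|[|//]]]]]]]] E _; rewrite /N in nN.
- by rewrite addn0.
- by [].
- by apply: PB; lia.
- by [].
- by rewrite -E2; [apply: PB|]; lia.
- by rewrite E5 //; lia.
- by rewrite E6 //; lia.
- by rewrite E7; [have [|] := PA q.+1; [lia|] |lia].
Qed.

Lemma twist_one_orbit d e : fconnect (vertex_perm twist_mesh) d e.
Proof. by apply: num_mesh_one_orbit; apply: twist_num_orbit. Qed.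

Lemma twist_connected : mesh_connected twist_mesh.
Proof.
apply: num_mesh_connected => f fN.
have [h|h] : f %% 2 = 0 \/ f %% 2 = 1 by lia.
  have nN : 4 * f + 1 < 4 * N by rewrite /N; lia.
  by exists (4 * f + 1); split=> //; [lia | case: (twistP nN); rewrite /N; lia].
have nN : 4 * f + 2 < 4 * N by rewrite /N; lia.
by exists (4 * f + 2); split=> //; [lia | case: (twistP nN); rewrite /N; lia].
Qed.

(** The loop through the squares [0] and [1] that leaves square [0] through
    side [1] and comes back through side [3], run [k] times. *)
Definition twist_loop (k : int) (n : nat) : int :=
  if (n == 1) || (n == 5) then k
  else if (n == 3) || (n == 4) then (- k)%R else 0%R.

Lemma twist_loop_cycle k :
  dual_cycle twist_mesh (fun d => twist_loop k (dart_num d)).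
Proof.
split=> [d|f] /=.
  rewrite num_glueE; have nN := dart_num_lt d.
  by rewrite /twist_loop; case: (twistP nN) => [->|->|?|?|??|??|??|??|??|??|??|??] //;
    rewrite /N; repeat (case: ifP => ?); lia.
rewrite (big_ord_recl 3) !big_ord_recl big_ord0 /twist_loop /dart_num /=.
by case: (nat_of_ord f) => [|[|m]] /=; repeat (case: ifP => ?); lia.
Qed.

(** Along the loop, the crossing from square [0] to square [1] has rotation [1]
    and the crossing back has rotation [0]. *)
Lemma twist_holonomy : holonomy_image twist_mesh = [set: 'Z_4]%classic.
Proof.
apply/seteqP; split=> // r _.
exists (fun d => twist_loop (nat_of_ord r)%:Z%R (dart_num d)).
  exact: twist_loop_cycle.
have N1 : 1 < 4 * N by rewrite /N; lia.
pose d1 := dart_of N1.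
have glue_num n (h : n < 4 * N) : dart_num (twist_mesh (dart_of h)) = twist_num n.
  by rewrite num_glueE dart_ofK.
rewrite /holonomy (bigD1 d1) /=; last first.
  by rewrite num_glueE dart_ofK; case: (twistP N1); rewrite /N; lia.
rewrite big1 => [|d /andP[lt nd1]].
  rewrite addr0 dart_ofK /twist_loop /= /rotation !dart_num_side glue_num dart_ofK.
  have -> : twist_num 1 = 4 by case: (twistP N1); rewrite /N; lia.
  rewrite -pmulrn (_ : (_ + _)%R = 1%R); last exact: val_inj.
  by rewrite natr_Zp.
have nd : dart_num d != 1.
  by apply: contraNneq nd1 => E; apply/eqP/dart_num_inj; rewrite dart_ofK.
have nN := dart_num_lt d.
have [E|n3] := eqVneq (dart_num d) 3; last first.
  have [n4 n5] : dart_num d != 4 /\ dart_num d != 5.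
    by move: lt; rewrite num_glueE; case: (twistP nN); rewrite /N; lia.
  rewrite /twist_loop (negPf nd) (negPf n3) (negPf n4) (negPf n5) /=.
  exact: mulr0z.
rewrite /rotation !dart_num_side num_glueE E.
have N3 : 3 < 4 * N by rewrite /N; lia.
have -> : twist_num 3 = 5 by case: (twistP N3); rewrite /N; lia.
rewrite (_ : (_ + _)%R = 0%R) ?mul0rz //; exact: val_inj.
Qed.

End Twisted.

(** * Coordinates in the plane *)

Section Plane.
Variable R : realType.
Local Notation C := (Cplx R).

(** Real and imaginary parts with values in [R], so that inequalities between
    them are accessible to real arithmetic. *)
Definition rC (x : R) : C := real_complex R x.
Definition re (z : C) : R := complex.Re z.
Definition im (z : C) : R := complex.Im z.

Lemma plane_eq (z w : C) : re z = re w -> im z = im w -> z = w.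
Proof. by case: z => a b; case: w => c d; rewrite /re /im /= => -> ->. Qed.

Lemma reD (z w : C) : re (z + w) = re z + re w.
Proof. by case: z => a b; case: w. Qed.
Lemma imD (z w : C) : im (z + w) = im z + im w.
Proof. by case: z => a b; case: w. Qed.
Lemma reN (z : C) : re (- z) = - re z.
Proof. by case: z. Qed.
Lemma imN (z : C) : im (- z) = - im z.
Proof. by case: z. Qed.
Lemma reM (z w : C) : re (z * w) = re z * re w - im z * im w.
Proof. by case: z => a b; case: w. Qed.
Lemma imM (z w : C) : im (z * w) = re z * im w + im z * re w.
Proof. by case: z => a b; case: w. Qed.
Lemma re_rC x : re (rC x) = x. Proof. by []. Qed.
Lemma im_rC x : im (rC x) = 0. Proof. by []. Qed.

Lemma rC0 : rC 0 = 0. Proof. by []. Qed.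
Lemma rC1 : rC 1 = 1. Proof. by []. Qed.
Lemma rCD x y : rC (x + y) = rC x + rC y.
Proof. by apply: plane_eq; rewrite ?reD ?imD ?im_rC ?addr0. Qed.
Lemma rCN x : rC (- x) = - rC x.
Proof. by apply: plane_eq; rewrite ?reN ?imN ?im_rC ?oppr0. Qed.
Lemma rCM x y : rC (x * y) = rC x * rC y.
Proof. by apply: plane_eq; rewrite ?reM ?imM ?im_rC ?mulr0 ?mul0r ?subr0 ?addr0. Qed.
Lemma rCX x n : rC (x ^+ n) = rC x ^+ n.
Proof. by elim: n => [|n IH]; rewrite ?exprS ?rCM ?IH. Qed.
Lemma rC_nat n : rC n%:R = n%:R.
Proof. by elim: n => [|n IH] //; rewrite -addn1 !natrD rCD IH. Qed.
Lemma rC_inj : injective rC.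
Proof. by move=> x y /(congr1 re). Qed.
Lemma rCV x : rC x^-1 = (rC x)^-1.
Proof.
have [->|x0] := eqVneq x 0; first by rewrite !(invr0, rC0).
have rx0 : rC x != 0 by apply: contraNneq x0 => /rC_inj ->.
by apply: (mulIf rx0); rewrite -rCM !mulVf.
Qed.

Lemma ler_rC x y : (rC x <= rC y) = (x <= y). Proof. exact: lecR. Qed.
Lemma ltr_rC x y : (rC x < rC y) = (x < y). Proof. exact: ltcR. Qed.

Lemma re1 : re 1 = 1. Proof. by []. Qed.
Lemma im1 : im 1 = 0. Proof. by []. Qed.
Lemma re0 : re 0 = 0. Proof. by []. Qed.
Lemma im0 : im 0 = 0. Proof. by []. Qed.

Lemma re_i : re 'i = 0. Proof. by []. Qed.
Lemma im_i : im 'i = 1. Proof. by []. Qed.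

Definition reimE := (reD, imD, reN, imN, reM, imM, re_rC, im_rC, re0, im0, re1,
  im1, re_i, im_i).

Lemma Re_rC (z : C) : 'Re z = rC (re z). Proof. by rewrite -complexRe. Qed.
Lemma Im_rC (z : C) : 'Im z = rC (im z). Proof. by rewrite -complexIm. Qed.

Definition mag (z : C) : R := Num.sqrt (re z ^+ 2 + im z ^+ 2).

Lemma norm_mag (z : C) : `|z| = rC (mag z).
Proof. exact: normc_def. Qed.

Lemma mag_ge0 z : 0 <= mag z. Proof. exact: sqrtr_ge0. Qed.

Lemma mag_sqr z : mag z ^+ 2 = re z ^+ 2 + im z ^+ 2.
Proof. by rewrite sqr_sqrtr // addr_ge0 ?sqr_ge0. Qed.

Lemma mag_eq0 z : (mag z == 0) = (z == 0).
Proof. by rewrite -(inj_eq rC_inj) -norm_mag normr_eq0. Qed.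

Lemma mag_gt0 z : (0 < mag z) = (z != 0).
Proof. by rewrite lt_def mag_eq0 mag_ge0 andbT. Qed.

Lemma magM z w : mag (z * w) = mag z * mag w.
Proof. by apply: rC_inj; rewrite rCM -!norm_mag normrM. Qed.

Lemma magN z : mag (- z) = mag z.
Proof. by apply: rC_inj; rewrite -!norm_mag normrN. Qed.

Lemma magX z n : mag (z ^+ n) = mag z ^+ n.
Proof. by apply: rC_inj; rewrite rCX -!norm_mag normrX. Qed.

Lemma mag_rC x : mag (rC x) = `|x|.
Proof. by rewrite /mag !reimE expr0n /= addr0 sqrtr_sqr. Qed.

Lemma magD z w : mag (z + w) <= mag z + mag w.
Proof. by rewrite -ler_rC rCD -!norm_mag ler_normD. Qed.

Lemma mag_i : mag 'i = 1.
Proof. by rewrite /mag !reimE expr0n expr1n add0r sqrtr1. Qed.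

Lemma mag_ge_re z : `|re z| <= mag z.
Proof. by rewrite -sqrtr_sqr ler_sqrt ?lerDl ?sqr_ge0 // addr_ge0 ?sqr_ge0. Qed.

Lemma mag_ge_im z : `|im z| <= mag z.
Proof. by rewrite -sqrtr_sqr ler_sqrt ?lerDr ?sqr_ge0 // addr_ge0 ?sqr_ge0. Qed.

Lemma unit_squareE (z : C) :
  unit_square z <-> [/\ 0 <= re z, re z <= 1, 0 <= im z & im z <= 1].
Proof.
rewrite /unit_square /= Re_rC Im_rC -rC0 -rC1 !ler_rC.
by split=> [/andP[/andP[? ?] /andP[? ?]]|[-> -> -> ->]].
Qed.

Lemma open_unit_squareE (z : C) :
  open_unit_square z <-> [/\ 0 < re z, re z < 1, 0 < im z & im z < 1].
Proof.
rewrite /open_unit_square /= Re_rC Im_rC -rC0 -rC1 !ltr_rC.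
by split=> [/andP[/andP[? ?] /andP[? ?]]|[-> -> -> ->]].
Qed.

Lemma unit_param (t : C) : 0 <= t <= 1 -> exists2 x, t = rC x & 0 <= x <= 1.
Proof.
move=> /andP[t0 t1]; have E : t = rC (re t).
  by apply: plane_eq; rewrite ?im_rC //; apply: ger0_Im.
by exists (re t) => //; move: t0 t1; rewrite E -rC0 -rC1 !ler_rC => -> ->.
Qed.

(** ** Sides of the unit square *)

Definition ctr : C := (1 + 'i) / 2.

Lemma re_ctr : re ctr = 1 / 2.
Proof. by rewrite /ctr -(rC_nat 2) -rCV !reimE; lra. Qed.
Lemma im_ctr : im ctr = 1 / 2.
Proof. by rewrite /ctr -(rC_nat 2) -rCV !reimE; lra. Qed.

Definition planeE := (re_ctr, im_ctr, reimE).

Lemma expr_i4 : ('i : C) ^+ 4 = 1.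
Proof. by rewrite (exprM 'i 2 2) sqrCi sqrrN expr1n. Qed.

Lemma expr_iD (s t : 'Z_4) : 'i ^+ (s + t)%R = 'i ^+ s * 'i ^+ t :> C.
Proof. by rewrite -exprD -(expr_mod (s + t) expr_i4). Qed.

Lemma side_pointE s (u : C) : side_point s u = ctr + 'i ^+ s * (u - ctr).
Proof. by []. Qed.

Lemma side_pointD s t (u : C) :
  side_point (s + t) u = side_point s (side_point t u).
Proof. by rewrite !side_pointE expr_iD addrAC subrr add0r mulrA. Qed.

Lemma side_point0 (u : C) : side_point 0 u = u.
Proof. by rewrite side_pointE expr0 mul1r addrC subrK. Qed.

Lemma side_pointK s : cancel (@side_point R s) (side_point (- s)).
Proof. by move=> u; rewrite -side_pointD addNr side_point0. Qed.

Lemma side_pointNK s : cancel (@side_point R (- s)) (side_point s).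
Proof. by move=> u; rewrite -side_pointD subrr side_point0. Qed.

Lemma side_pointB s (u v : C) :
  side_point s u - side_point s v = 'i ^+ s * (u - v).
Proof. by rewrite !side_pointE; ring. Qed.

Lemma mag_iX n : mag ('i ^+ n) = 1.
Proof. by rewrite magX mag_i expr1n. Qed.

Lemma mag_side_pointB s (u v : C) :
  mag (side_point s u - side_point s v) = mag (u - v).
Proof. by rewrite side_pointB magM mag_iX mul1r. Qed.

Lemma re_side1 (u : C) : re (side_point 1 u) = 1 - im u.
Proof. rewrite side_pointE expr1 !planeE; lra. Qed.
Lemma im_side1 (u : C) : im (side_point 1 u) = re u.
Proof. by rewrite side_pointE expr1 !planeE; lra. Qed.

Definition sideE := (re_side1, im_side1, planeE).

Lemma side2 (u : C) : side_point 2 u = side_point 1 (side_point 1 u).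
Proof. by rewrite -side_pointD. Qed.
Lemma side3 (u : C) : side_point 3 u = side_point 1 (side_point 2 u).
Proof. by rewrite -side_pointD. Qed.

(** Proofs by cases over the four sides. *)
Lemma side_ind (P : 'Z_4 -> Prop) : P 0 -> P 1 -> P 2 -> P 3 -> forall s, P s.
Proof.
move=> P0 P1 P2 P3 [[|[|[|[|//]]]] h];
by [rewrite (_ : Ordinal h = 0); [|exact: val_inj]
   |rewrite (_ : Ordinal h = 1); [|exact: val_inj]
   |rewrite (_ : Ordinal h = 2); [|exact: val_inj]
   |rewrite (_ : Ordinal h = 3); [|exact: val_inj]].
Qed.

Lemma unit_square_side s (u : C) : unit_square u -> unit_square (side_point s u).
Proof.
have S1 (v : C) : unit_square v -> unit_square (side_point 1 v).
  move=> /unit_squareE[*]; apply/unit_squareE.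
  by rewrite re_side1 im_side1; split; lra.
move=> hu; elim/side_ind: s.
- by rewrite side_point0.
- exact: S1.
- by rewrite side2; do 2 apply: (S1).
- by rewrite side3 side2; do 3 apply: (S1).
Qed.

Lemma unit_square_sideE s (u : C) : unit_square (side_point s u) <-> unit_square u.
Proof.
by split=> [/(unit_square_side (- s))|]; [rewrite side_pointK|apply: unit_square_side].
Qed.

Lemma unit_square_real x : 0 <= x <= 1 -> unit_square (rC x).
Proof. by move=> /andP[? ?]; apply/unit_squareE; rewrite !planeE; split; lra. Qed.

(** Two sides [s] and [s'] compare like the sides [0] and [s' - s]. *)
Lemma mag_side_pointB2 s s' (u v : C) :
  mag (side_point s' u - side_point s v) = mag (side_point (s' - s) u - v).
Proof.
have E : s' = s + (s' - s) by rewrite addrC subrK.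
by rewrite [in LHS]E side_pointD mag_side_pointB.
Qed.

(** The next three lemmas say which sides meet the discs of radius [1/2] about
    the centre, [1/4] about a midpoint and [1/2] about a corner. *)
Lemma side_center_far s x : 1 / 2 <= mag (side_point s (rC x) - ctr).
Proof.
have -> : ctr = side_point s ctr by rewrite side_pointE subrr mulr0 addr0.
rewrite mag_side_pointB; apply: le_trans (mag_ge_im _).
by rewrite !planeE sub0r normrN ger0_norm; lra.
Qed.

Lemma side_mid_near s s' x : 0 <= x <= 1 ->
  mag (side_point s' (rC x) - side_point s (rC (1 / 2))) < 1 / 4 -> s' = s.
Proof.
move=> /andP[x0 x1]; rewrite mag_side_pointB2 => h.
apply/eqP; rewrite -subr_eq0; move: h; move: (s' - s) => d h; apply/eqP.
have {}h := (le_lt_trans (mag_ge_re _) h, le_lt_trans (mag_ge_im _) h).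
move: h; rewrite !ltr_norml; elim/side_ind: d => // -[h1 h2]; exfalso; move: h1 h2;
rewrite ?side3 ?side2 ?side_point0 ?sideE ?side_point0; lra.
Qed.

Lemma side_corner_near s s' x : 0 <= x <= 1 ->
  mag (side_point s' (rC x) - side_point s 0) < 1 / 2 ->
  s' = s /\ x < 1 / 2 \/ s' = s - 1 /\ 1 - x < 1 / 2.
Proof.
move=> /andP[x0 x1]; rewrite mag_side_pointB2 => h.
have : s' - s = 0 /\ x < 1 / 2 \/ s' - s = 3 /\ 1 - x < 1 / 2.
  have {}h := (le_lt_trans (mag_ge_re _) h, le_lt_trans (mag_ge_im _) h).
  move: h; rewrite !ltr_norml; elim/side_ind: (s' - s) => //;
  rewrite ?side3 ?side2 ?side_point0 ?sideE ?side_point0.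
  - by move=> [? ?]; left; split=> //; lra.
  - by move=> [? ?]; exfalso; lra.
  - by move=> [? ?]; exfalso; lra.
  - by move=> [? ?]; right; split=> //; lra.
case=> [] [E hx]; [left|right]; split=> //; rewrite -(subrK s s') E.
  by rewrite add0r.
by rewrite addrC; congr (_ + _); apply: val_inj.
Qed.

(** The centres of two discs with a common point would be closer to each other
    than distinct midpoints, resp. distinct corners, are. *)
Lemma mid_disjoint s s' (z : C) :
  mag (z - side_point s (rC (1 / 2))) < 1 / 4 ->
  mag (z - side_point s' (rC (1 / 2))) < 1 / 4 -> s' = s.
Proof.
move=> h h'; have {h h'} : mag (side_point s' (rC (1/2)) - side_point s (rC (1/2))) < 1/2.
  have -> : side_point s' (rC (1/2)) - side_point s (rC (1/2)) =
     (z - side_point s (rC (1/2))) - (z - side_point s' (rC (1/2))) by ring.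
  by apply: le_lt_trans (magD _ _) _; rewrite magN; lra.
rewrite mag_side_pointB2 => h.
apply/eqP; rewrite -subr_eq0; move: h; move: (s' - s) => d h; apply/eqP.
have {}h := (le_lt_trans (mag_ge_re _) h, le_lt_trans (mag_ge_im _) h).
move: h; rewrite !ltr_norml; elim/side_ind: d => // -[h1 h2]; exfalso; move: h1 h2;
rewrite ?side3 ?side2 ?side_point0 ?sideE ?side_point0; lra.
Qed.

Lemma corner_disjoint s s' (z : C) :
  mag (z - side_point s 0) < 1 / 2 ->
  mag (z - side_point s' 0) < 1 / 2 -> s' = s.
Proof.
move=> h h'; have {h h'} : mag (side_point s' 0 - side_point s 0) < 1.
  have -> : side_point s' 0 - side_point s 0 =
     (z - side_point s 0) - (z - side_point s' 0) by ring.
  by apply: le_lt_trans (magD _ _) _; rewrite magN; lra.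
rewrite mag_side_pointB2 => h.
apply/eqP; rewrite -subr_eq0; move: h; move: (s' - s) => d h; apply/eqP.
have {}h := (le_lt_trans (mag_ge_re _) h, le_lt_trans (mag_ge_im _) h).
move: h; rewrite !ltr_norml; elim/side_ind: d => // -[h1 h2]; exfalso; move: h1 h2;
rewrite ?side3 ?side2 ?side_point0 ?sideE ?side_point0; lra.
Qed.

(** The following two bounds keep the corners out of the discs about centres and
    midpoints. *)
Lemma corner_center_far s : 1 / 2 <= mag (side_point s 0 - ctr).
Proof. exact: (side_center_far s 0). Qed.

Lemma corner_mid_far s s' :
  1 / 4 <= mag (side_point s' 0 - side_point s (rC (1 / 2))).
Proof.
rewrite leNgt; apply/negP => h.
have E : s' = s by apply: (@side_mid_near s s' 0) h; lra.
by move: h; rewrite E mag_side_pointB sub0r magN mag_rC ger0_norm; lra.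
Qed.

(** The discs of radius [1/2] about the centre and the corners miss only the
    midpoints of the sides. *)
Lemma square_covered (z : C) : unit_square z ->
  [\/ mag (z - ctr) < 1 / 2,
      exists s, mag (z - side_point s (rC (1 / 2))) < 1 / 4 |
      exists s, mag (z - side_point s 0) < 1 / 2].
Proof.
(* some rotation brings [z] into the lower left quarter *)
have key (v : C) : re v <= 1/2 -> im v <= 1/2 -> unit_square v ->
   [\/ mag (v - ctr) < 1 / 2,
      exists s, mag (v - side_point s (rC (1 / 2))) < 1 / 4 |
      exists s, mag (v - side_point s 0) < 1 / 2].
  move=> a1 b1; move=> /unit_squareE[a0 _ b0 _].
  have [h|h] := ltP (mag (v - ctr)) (1/2); first exact: Or31.
  have [h'|h'] := ltP (mag (v - side_point 0 0)) (1/2).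
    by apply: Or33; exists 0.
  apply: Or32.
  have {h}h : 1/4 <= (re v - 1/2) ^+ 2 + (im v - 1/2) ^+ 2.
    have := mag_sqr (v - ctr); rewrite !planeE; nra.
  have {h'}h' : 1/4 <= re v ^+ 2 + im v ^+ 2.
    by move: h'; rewrite side_point0 subr0 => h'; have := mag_sqr v; nra.
  have [E|E] : (re v = 1/2 /\ im v = 0) \/ (re v = 0 /\ im v = 1/2).
    set a := 1/2 - re v; set b := im v.
    have ra : re v = 1/2 - a by rewrite /a; lra.
    (* being outside both discs confines [a] and [b] to the cusp between them *)
    have B1 : a / 2 <= b ^+ 2 by rewrite ra -/b in a0 a1 h h' *; nra.
    have B2 : b / 2 <= a ^+ 2 by rewrite ra -/b in a0 a1 h h' *; nra.
    have ab : a = b by apply/eqP; rewrite eq_le /a /b; apply/andP; split; nra.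
    have : a * (a - 1/2) = 0 by rewrite /a /b in ab B1 B2 *; nra.
    move/eqP; rewrite mulf_eq0 => /orP[]/eqP ?; [left|right]; lra.
  - exists 0; rewrite (_ : _ - _ = 0); first by rewrite (_ : mag 0 = 0) ?lt0r; [lra|apply/eqP; rewrite mag_eq0].
    by apply: plane_eq; rewrite side_point0 !planeE; lra.
  - exists 3; rewrite (_ : _ - _ = 0); first by rewrite (_ : mag 0 = 0) ?lt0r; [lra|apply/eqP; rewrite mag_eq0].
    by apply: plane_eq; rewrite side3 side2 ?side_point0 ?sideE; lra.
have rot s (v : C) : unit_square v -> re (side_point s v) <= 1/2 -> im (side_point s v) <= 1/2 ->
   [\/ mag (v - ctr) < 1 / 2,
      exists s, mag (v - side_point s (rC (1 / 2))) < 1 / 4 |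
      exists s, mag (v - side_point s 0) < 1 / 2].
  move=> /(unit_square_side s) hv a1 b1.
  have cE : ctr = side_point s ctr by rewrite side_pointE subrr mulr0 addr0.
  have [h|[t h]|[t h]] := key _ a1 b1 hv.
  - by apply: Or31; rewrite -(mag_side_pointB s) -cE.
  - apply: Or32; exists (- s + t).
    by rewrite -(mag_side_pointB s) -side_pointD addrA subrr add0r.
  - apply: Or33; exists (- s + t).
    by rewrite -(mag_side_pointB s) -side_pointD addrA subrr add0r.
move=> hz; have [hr|hr] := leP (re z) (1/2); have [hi|hi] := leP (im z) (1/2).
- exact: key.
- by apply: (rot 1) => //; rewrite ?sideE; lra.
- by apply: (rot 3) => //; rewrite side3 side2 ?sideE; lra.
- by apply: (rot 2) => //; rewrite side2 ?sideE; lra.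
Qed.

End Plane.

(** * Topology of the plane and polar coordinates *)

Section PlaneTopology.
Variable R : realType.
Local Notation C := (Cplx R).

Lemma near_magP (z : C) (P : C -> Prop) :
  (\forall w \near z, P w) <->
  exists2 e : R, 0 < e & forall w, mag (z - w) < e -> P w.
Proof.
split=> [/nbhs_normP[e /= e0 H]|[e e0 H]].
  have E : e = rC (re e).
    by apply: plane_eq; rewrite ?im_rC //; apply: ger0_Im; apply: ltW.
  exists (re e); first by rewrite -ltr_rC -E.
  by move=> w hw; apply: H; rewrite /ball_ /= norm_mag E ltr_rC.
apply/nbhs_normP; exists (rC e) => /=; first by rewrite -rC0 ltr_rC.
by move=> w; rewrite /ball_ /= norm_mag ltr_rC => /H.
Qed.

Lemma continuous_re : continuous (@re R).
Proof.
move=> z; apply/(@cvgrPdist_lt _ _ _ (nbhs z) (nbhs_filter z)) => e e0; apply/near_magP; exists e => // w h.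
by rewrite -reN -reD; apply: le_lt_trans (mag_ge_re _) h.
Qed.

Lemma continuous_im : continuous (@im R).
Proof.
move=> z; apply/(@cvgrPdist_lt _ _ _ (nbhs z) (nbhs_filter z)) => e e0; apply/near_magP; exists e => // w h.
by rewrite -imN -imD; apply: le_lt_trans (mag_ge_im _) h.
Qed.

Lemma continuous_mag : continuous (@mag R).
Proof.
move=> z; apply/(@cvgrPdist_lt _ _ _ (nbhs z) (nbhs_filter z)) => e e0; apply/near_magP; exists e => // w h.
rewrite ltr_norml; apply/andP.
have h1 := magD (z - w) w; have h2 := magD (w - z) z.
rewrite !subrK in h1 h2; have h3 := magN (z - w); rewrite opprB in h3.
by split; lra.
Qed.

Lemma continuous_rC : continuous (@rC R).
Proof.
move=> x; apply/cvgrPdist_lt => e e0.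
have E : e = rC (re e).
  by apply: plane_eq; rewrite ?im_rC //; apply: ger0_Im; apply: ltW.
have r0 : 0 < re e by rewrite -ltr_rC -E.
near=> y; rewrite -rCN -rCD norm_mag mag_rC E ltr_rC.
by near: y; apply: cvgr_dist_lt.
Unshelve. all: by end_near. Qed.

(** ** Polar coordinates *)

Definition cis (x : R) : C := rC (cos x) + 'i * rC (sin x).

Lemma re_cis x : re (cis x) = cos x.
Proof. by rewrite /cis !reimE; ring. Qed.
Lemma im_cis x : im (cis x) = sin x.
Proof. by rewrite /cis !reimE; ring. Qed.

Lemma cisD x y : cis (x + y) = cis x * cis y.
Proof.
apply: plane_eq; rewrite ?reM ?imM !re_cis !im_cis ?cosD ?sinD //; ring.
Qed.

Lemma cis0 : cis 0 = 1.
Proof. by apply: plane_eq; rewrite ?re_cis ?im_cis ?cos0 ?sin0. Qed.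

Lemma cisX x n : cis (x * n%:R) = cis x ^+ n.
Proof.
elim: n => [|n IH]; first by rewrite mulr0 cis0 expr0.
by rewrite -addn1 natrD mulrDr mulr1 cisD IH addn1 exprSr.
Qed.

Lemma mag_cis x : mag (cis x) = 1.
Proof. by rewrite /mag re_cis im_cis cos2Dsin2 sqrtr1. Qed.

Lemma cis_neq0 x : cis x != 0.
Proof. by rewrite -mag_eq0 mag_cis oner_eq0. Qed.

Lemma cis_pihalf : cis (pi / 2) = 'i.
Proof.
by apply: plane_eq; rewrite ?re_cis ?im_cis ?cos_pihalf ?sin_pihalf ?re_i ?im_i.
Qed.

Lemma cis_2pi : cis (pi *+ 2) = 1.
Proof. by apply: plane_eq; rewrite ?re_cis ?im_cis ?cos2pi ?sin2pi. Qed.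

Lemma continuous_cis : continuous cis.
Proof.
move=> x; apply: cvgD.
  exact: cvg_comp (@continuous_cos R x) (@continuous_rC (cos x)).
apply: cvgM; first exact: cvg_cst.
exact: cvg_comp (@continuous_sin R x) (@continuous_rC (sin x)).
Qed.

Lemma cis_eq1 x : 0 <= x < pi *+ 2 -> cis x = 1 -> x = 0.
Proof.
move=> /andP[x0 x2] /(congr1 (@re R)); rewrite re_cis re1 => c1.
have pi0 := pi_gt0 R; rewrite mulr2n in x2.
have [xp|xp] := leP x pi.
  by apply: cos_inj; rewrite ?in_itv /= ?cos0 //; lra.
have : pi *+ 2 - x = 0.
  apply: cos_inj; rewrite ?in_itv /= ?cos0.
  - by rewrite mulr2n; lra.
  - lra.
  - by rewrite cosB cos2pi sin2pi mul1r mul0r addr0.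
by rewrite mulr2n; lra.
Qed.

(** Angles are determined up to a full turn. *)
Lemma cis_inj x y : `|x - y| < pi *+ 2 -> cis x = cis y -> x = y.
Proof.
wlog yx : x y / y <= x.
  move=> H d E; have [yx|xy] := leP y x; first exact: H.
  by apply/esym/H; [exact: ltW | rewrite distrC | ].
move=> d E; apply/eqP; rewrite -subr_eq0; apply/eqP; apply: cis_eq1.
  by rewrite subr_ge0 yx /=; apply: le_lt_trans d; apply: ler_norm.
by apply: (mulIf (cis_neq0 y)); rewrite -cisD subrK mul1r.
Qed.

(** The angle of a point of the closed first quadrant, by the half-angle
    formula: it is continuous up to both axes. *)
Definition quadrant : set C := [set u | 0 <= re u /\ 0 <= im u].

Definition qarg (u : C) : R := 2 * atan (im u / (mag u + re u)).

Lemma mag_re_gt0 u : quadrant u -> u != 0 -> 0 < mag u + re u.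
Proof. by move=> [r0 _]; rewrite -mag_gt0 => m; lra. Qed.

Lemma qarg_ge0 u : quadrant u -> 0 <= qarg u.
Proof.
move=> [r0 i0]; rewrite mulr_ge0 //.
have : atan 0 <= atan (im u / (mag u + re u)) by apply: le_atan; rewrite divr_ge0 ?addr_ge0 ?mag_ge0.
by rewrite atan0.
Qed.

Lemma qarg_le u : quadrant u -> qarg u <= pi / 2.
Proof.
move=> qu; have [->|u0] := eqVneq u 0.
  by rewrite /qarg im0 mul0r atan0 mulr0 divr_ge0 ?pi_ge0.
have d0 := mag_re_gt0 qu u0; case: qu => r0 i0.
have : atan (im u / (mag u + re u)) <= atan 1.
  apply: le_atan; rewrite ler_pdivrMr // mul1r.
  by have := mag_ge_im u; have := ler_norm (im u); lra.
by rewrite atan1 /qarg; lra.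
Qed.

(** With [y] the tangent of the half angle, [cos] and [sin] of the full angle are
    [(1 - y^2) / (1 + y^2)] and [2 y / (1 + y^2)]. *)
Lemma qarg_polar u : quadrant u -> u = rC (mag u) * cis (qarg u).
Proof.
move=> qu; have [->|u0] := eqVneq u 0.
  have /eqP -> : mag (0 : C) == 0 by rewrite mag_eq0.
  by rewrite rC0 mul0r.
have d0 := mag_re_gt0 qu u0.
set d := mag u + re u in d0; set y := im u / d.
have sE : sin (atan y) = y * cos (atan y).
  have c0 : cos (atan y) != 0.
    by rewrite cos_atan invr_eq0 gt_eqF // sqrtr_gt0 ltr_wpDr ?sqr_ge0.
  by have := atanK y; rewrite /tan => h; rewrite -[LHS](mulfVK c0) h.
have c2 : cos (atan y) ^+ 2 * (1 + y ^+ 2) = 1.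
  by have := cos2Dsin2 (atan y); rewrite sE => h; rewrite -[RHS]h; ring.
have E : qarg u = atan y + atan y by rewrite /qarg -/d -/y; ring.
have m2 := mag_sqr u; have iE : im u = y * d by rewrite /y mulfVK // gt_eqF.
have key : (mag u - re u) = y ^+ 2 * d.
  apply: (mulIf (lt0r_neq0 d0)); rewrite {1}/d -mulrA -expr2 -exprMn -iE.
  by rewrite -subr_sqr m2; ring.
have mE : mag u * 2 = (1 + y ^+ 2) * d by rewrite mulrDl -key /d; ring.
have rE : re u * 2 = (1 - y ^+ 2) * d by rewrite mulrBl -key /d; ring.
set c := cos (atan y) in sE c2.
have mc : mag u * c ^+ 2 * 2 = d.
  have -> : mag u * c ^+ 2 * 2 = c ^+ 2 * (mag u * 2) by ring.
  by rewrite mE mulrA c2 mul1r.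
apply: plane_eq; rewrite ?reM ?imM ?re_rC ?im_rC E cisD ?reM ?imM re_cis im_cis sE -/c.
- have -> : mag u * (c * c - y * c * (y * c)) - 0 * (c * (y * c) + y * c * c) = (mag u * c ^+ 2 * 2) * (1 - y ^+ 2) / 2 by field.
  by rewrite mc; lra.
- have -> : mag u * (c * (y * c) + y * c * c) + 0 * (c * c - y * c * (y * c)) = (mag u * c ^+ 2 * 2) * y by field.
  by rewrite mc iE mulrC.
Qed.

Lemma qarg_rC x : 0 < x -> qarg (rC x) = 0.
Proof. by move=> x0; rewrite /qarg im_rC mul0r atan0 mulr0. Qed.

Lemma qarg_i x : 0 < x -> qarg ('i * rC x) = pi / 2.
Proof.
move=> x0; rewrite /qarg magM mag_i mul1r mag_rC gtr0_norm //.
rewrite !reimE mul1r mul0r add0r mul0r sub0r mulr0 oppr0 !addr0 divff ?gt_eqF // atan1; lra.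
Qed.

Lemma continuous_qarg u : quadrant u -> u != 0 -> {for u, continuous qarg}.
Proof.
move=> qu u0; have d0 := mag_re_gt0 qu u0.
have cq : {for u, continuous (fun v : C => im v / (mag v + re v))}.
  apply: (@continuousM _ _ (@im R) (fun v => (mag v + re v)^-1)).
    exact: continuous_im.
  apply: (@continuousV _ _ (fun v => mag v + re v)); first by rewrite gt_eqF.
  apply: (@continuousD _ _ _ (@mag R) (@re R)); first exact: continuous_mag.
  exact: continuous_re.
apply: (@continuousM _ _ (fun=> 2) (fun v : C => atan (im v / (mag v + re v)))).
  exact: cst_continuous.
apply: (continuous_comp cq); exact: continuous_atan.
Qed.

End PlaneTopology.

(** * The root on a cone of [4 * N] quadrants *)

Section RootPetals.
Variables (R : realType) (N : nat).
Hypothesis N0 : (0 < N)%N.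
Local Notation C := (Cplx R).

(** The [N]-th root of ['i ^ k * u] for [u] in the closed first quadrant, with the
    angle counted from the first of the quadrants [k = 0, 1, ..., 4 * N - 1]. *)
Definition root_petal (k : nat) (u : C) : C :=
  rC (mag u `^ N%:R^-1) * cis ((qarg u + k%:R * (pi / 2)) / N%:R).

Let NR0 : N%:R != 0 :> R.
Proof. by rewrite pnatr_eq0 -lt0n. Qed.

Let NR_gt0 : 0 < N%:R :> R.
Proof. by rewrite ltr0n. Qed.

Lemma root_powR (x : R) : 0 <= x -> (x `^ N%:R^-1) ^+ N = x.
Proof. by move=> x0; rewrite -powR_mulrn ?powR_ge0 // -powRrM mulVf // powRr1. Qed.

Lemma powR_root (x : R) : 0 <= x -> (x ^+ N) `^ N%:R^-1 = x.
Proof. by move=> x0; rewrite -powR_mulrn // -powRrM divff // powRr1. Qed.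

Lemma mag_root_petal k u : mag (root_petal k u) = mag u `^ N%:R^-1.
Proof. by rewrite magM mag_cis mulr1 mag_rC ger0_norm // powR_ge0. Qed.

Lemma root_petalX k u : quadrant u -> root_petal k u ^+ N = 'i ^+ k * u.
Proof.
move=> qu; rewrite exprMn -rCX root_powR ?mag_ge0 // -cisX mulfVK // cisD.
rewrite [in LHS]mulrC -mulrA [k%:R * _]mulrC cisX cis_pihalf mulrCA.
by rewrite [cis _ * _]mulrC -qarg_polar.
Qed.

Lemma powR_continuous (a x : R) : 0 < x -> {for x, continuous (fun y : R => y `^ a)}.
Proof.
move=> x0; apply: differentiable_continuous; apply/derivable1_diffP.
by apply: derivable_powR; rewrite in_itv /= x0.
Qed.

(** At [0] the angle is not continuous, but the absolute value tends to [0]. *)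
Lemma continuous_root_petal k u : quadrant u ->
  {for u, continuous (root_petal k)}.
Proof.
move=> qu; have [->|u0] := eqVneq u 0.
  have z0 : mag (0 : C) = 0 by apply/eqP; rewrite mag_eq0.
  apply/(@cvgrPdist_lt _ _ _ (nbhs (0 : C)) (nbhs_filter (0 : C))) => e e0.
  have E : e = rC (re e).
    by apply: plane_eq; rewrite ?im_rC //; apply: ger0_Im; apply: ltW.
  have r0 : 0 < re e by rewrite -ltr_rC -E.
  apply/near_magP; exists (re e ^+ N); first by rewrite exprn_gt0.
  move=> w; rewrite sub0r magN => h.
  rewrite {1}/root_petal z0 powR0 ?invr_neq0 // rC0 mul0r sub0r normrN norm_mag E ltr_rC.
  rewrite mag_root_petal -(@powR_root (re e)) ?ltW //.
  apply: gt0_ltr_powR => //; rewrite ?invr_gt0 // ?nnegrE ?mag_ge0 //.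
  by rewrite exprn_ge0 // ltW.
have m0 : 0 < mag u by rewrite mag_gt0.
apply: (@continuousM _ _ (fun u => rC (mag u `^ N%:R^-1))
   (fun u => cis ((qarg u + k%:R * (pi / 2)) / N%:R))).
  have c1 : {for u, continuous (fun v : C => mag v `^ N%:R^-1)}.
    apply: (@continuous_comp _ _ _ (@mag R) (fun y : R => y `^ N%:R^-1)).
      exact: continuous_mag.
    exact: powR_continuous.
  by apply: (continuous_comp c1); exact: continuous_rC.
have c2 : {for u, continuous (fun v : C => (qarg v + k%:R * (pi / 2)) / N%:R)}.
  apply: (@continuousM _ _ (fun v : C => qarg v + k%:R * (pi / 2)) (fun=> N%:R^-1)).
    apply: (@continuousD _ _ _ (@qarg R) (fun=> k%:R * (pi / 2))).
      exact: continuous_qarg.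
    exact: cst_continuous.
  exact: cst_continuous.
by apply: (continuous_comp c2); exact: continuous_cis.
Qed.

Lemma root_petal_eq0 k u : (root_petal k u == 0) = (u == 0).
Proof.
by rewrite -mag_eq0 mag_root_petal powR_eq0 invr_eq0 NR0 andbT mag_eq0.
Qed.

Lemma root_petal0 k : root_petal k 0 = 0.
Proof. by apply/eqP; rewrite root_petal_eq0. Qed.

(** The imaginary axis of a petal is the real axis of the next one. *)
Lemma root_petal_next k t : 0 <= t ->
  root_petal k ('i * rC t) = root_petal k.+1 (rC t).
Proof.
rewrite le_eqVlt => /predU1P[<-|t0]; first by rewrite rC0 mulr0 !root_petal0.
rewrite /root_petal qarg_i // qarg_rC // magM mag_i mul1r add0r; congr (_ * cis (_ / _)).
by rewrite -addn1 natrD; ring.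
Qed.

(** After [4 * N] quadrants the root has made one full turn. *)
Lemma root_petal_period u : root_petal (4 * N) u = root_petal 0 u.
Proof.
rewrite /root_petal; congr (_ * _); rewrite mul0r addr0 mulrDl cisD.
have -> : (4 * N)%:R * (pi / 2) / N%:R = pi *+ 2 :> R.
  by rewrite natrM mulr2n; field.
by rewrite cis_2pi mulr1.
Qed.

(** ** Injectivity and surjectivity *)

Let tp : pi *+ 2 = 2 * pi :> R.
Proof. by rewrite mulr_natl. Qed.

Lemma pi_pos : 0 < pi :> R. Proof. exact: pi_gt0. Qed.

(** The ways in which a point of petal [k] and a point of petal [k'] can have the
    same root: they are identified when the quadrants are glued cyclically along
    their axes. *)
Variant petals_meet (k : nat) (u : C) (k' : nat) (u' : C) : Prop :=
| MeetCentre of u = 0 & u' = 0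
| MeetInside of k = k' & u = u'
| MeetAfter t of 0 <= t & u = 'i * rC t & u' = rC t & k' = (k.+1 %% (4 * N))%N
| MeetBefore t of 0 <= t & u = rC t & u' = 'i * rC t & k = (k'.+1 %% (4 * N))%N.

Lemma root_petal_inj k k' u u' : (k < 4 * N)%N -> (k' < 4 * N)%N ->
  quadrant u -> quadrant u' -> root_petal k u = root_petal k' u' ->
  petals_meet k u k' u'.
Proof.
pose ang k u : R := qarg u + k%:R * (pi / 2).
wlog le_a : k k' u u' / ang k u <= ang k' u'.
  move=> H kN kN' qu qu' E; have [h|/ltW h] := leP (ang k u) (ang k' u').
    exact: H.
  have [? ?|? ?|t ? ? ? ?|t ? ? ? ?] := H _ _ _ _ h kN' kN qu' qu (esym E).
  - exact: MeetCentre.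
  - exact: MeetInside.
  - exact: (@MeetBefore _ _ _ _ t).
  - exact: (@MeetAfter _ _ _ _ t).
move=> kN kN' qu qu' E.
have mE : mag u = mag u'.
  have := congr1 (@mag R) E; rewrite !mag_root_petal => /(congr1 (fun x => x ^+ N)).
  by rewrite !root_powR ?mag_ge0.
have [u0|u0] := eqVneq u 0.
  apply: MeetCentre => //; apply/eqP; rewrite -mag_eq0 -mE u0.
  by rewrite mag_eq0.
have m0 : 0 < mag u by rewrite mag_gt0.
have P0 := pi_pos.
have a0 := qarg_ge0 qu; have a1 := qarg_le qu.
have b0 := qarg_ge0 qu'; have b1 := qarg_le qu'.
have cE : cis (ang k u / N%:R) = cis (ang k' u' / N%:R).
  have : rC (mag u `^ N%:R^-1) != 0.
    by rewrite -mag_eq0 mag_rC normr_eq0 gt_eqF // powR_gt0.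
  by move=> c0; apply: (mulfI c0); rewrite [in RHS]mE.
have kR : k%:R + 1 <= 4 * N%:R :> R by rewrite natr1 -natrM ler_nat.
have kR' : k'%:R + 1 <= 4 * N%:R :> R by rewrite natr1 -natrM ler_nat.
have k0 : 0 <= k%:R :> R by rewrite ler0n.
have k0' : 0 <= k'%:R :> R by rewrite ler0n.
have pu := qarg_polar qu; have pu' := qarg_polar qu'; rewrite -mE in pu'.
have a_ge : 0 <= ang k u by rewrite addr_ge0 // mulr_ge0 // divr_ge0 // ltW.
have a'_le : ang k' u' <= pi *+ 2 * N%:R.
  have : (k'%:R + 1) * pi <= 4 * N%:R * pi :> R by rewrite ler_pM2r.
  by rewrite /ang tp; lra.
have [lt|ge] := ltP (ang k' u' - ang k u) (pi *+ 2 * N%:R).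
  (* the same angle *)
  have : ang k u / N%:R = ang k' u' / N%:R.
    apply: cis_inj => //; rewrite distrC -mulrBl ger0_norm.
      by rewrite ltr_pdivrMr.
    by rewrite divr_ge0 ?subr_ge0 // ltW.
  move/(mulIf (invr_neq0 NR0)); rewrite /ang => aE.
  have [kk|kk|kk] := ltngtP k k'.
  - have kkR : k%:R + 1 <= k'%:R :> R by rewrite natr1 ler_nat.
    have q1 : qarg u = pi / 2 by apply/eqP; rewrite eq_le a1 /=; nra.
    have q2 : qarg u' = 0 by nra.
    have kE : k'%:R = k%:R + 1 :> R by apply: (mulIf (lt0r_neq0 P0)); nra.
    move: kE; rewrite natr1 => /eqP; rewrite eqr_nat => /eqP kE.
    apply: (@MeetAfter _ _ _ _ (mag u)).
    + exact: mag_ge0.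
    + by rewrite {1}pu q1 cis_pihalf mulrC.
    + by rewrite {1}pu' q2 cis0 mulr1.
    + by rewrite modn_small -?kE.
  - have kkR : k'%:R + 1 <= k%:R :> R by rewrite natr1 ler_nat.
    have q1 : qarg u' = pi / 2 by apply/eqP; rewrite eq_le b1 /=; nra.
    have q2 : qarg u = 0 by nra.
    have kE : k%:R = k'%:R + 1 :> R by apply: (mulIf (lt0r_neq0 P0)); nra.
    move: kE; rewrite natr1 => /eqP; rewrite eqr_nat => /eqP kE.
    apply: (@MeetBefore _ _ _ _ (mag u)).
    + exact: mag_ge0.
    + by rewrite {1}pu q2 cis0 mulr1.
    + by rewrite {1}pu' q1 cis_pihalf mulrC.
    + by rewrite modn_small -?kE.
  - apply: MeetInside => //; rewrite pu pu'; congr (_ * cis _).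
    by move: aE; rewrite kk => /addIr.
(* a full turn apart: the first petal meets the last one *)
have aE : ang k u = 0 by lra.
have a'E : ang k' u' = pi *+ 2 * N%:R by lra.
have q2 : qarg u = 0 by move: aE; rewrite /ang; nra.
have q1 : qarg u' = pi / 2.
  by apply/eqP; rewrite eq_le b1 /=; move: a'E; rewrite /ang tp; nra.
have k'E : k'%:R + 1 = 4 * N%:R :> R.
  by apply: (mulIf (lt0r_neq0 P0)); move: a'E; rewrite /ang q1 tp; lra.
have kE : k%:R = 0 :> R.
  by apply: (mulIf (lt0r_neq0 P0)); move: aE; rewrite /ang q2; lra.
move: k'E; rewrite natr1 -natrM => /eqP; rewrite eqr_nat => /eqP k'E.
move/eqP: kE; rewrite pnatr_eq0 => /eqP kE.
apply: (@MeetBefore _ _ _ _ (mag u)).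
- exact: mag_ge0.
- by rewrite {1}pu q2 cis0 mulr1.
- by rewrite {1}pu' q1 cis_pihalf mulrC.
- by rewrite k'E modnn.
Qed.

Lemma quadrant_polar r x : 0 <= r -> 0 <= x <= pi / 2 ->
  quadrant (rC r * cis x : C).
Proof.
move=> r0 /andP[x0 x1]; have P0 := pi_pos.
split; rewrite ?reM ?imM re_rC im_rC re_cis im_cis !mul0r ?subr0 ?addr0
  mulr_ge0 ?cos_ge0_pihalf ?sin_ge0_pi //; lra.
Qed.

Lemma qarg_unique r x : 0 < r -> 0 <= x <= pi / 2 ->
  qarg (rC r * cis x : C) = x.
Proof.
move=> r0 xI; have qu := quadrant_polar (ltW r0) xI.
have a0 := qarg_ge0 qu; have a1 := qarg_le qu; have P0 := pi_pos.
apply: cis_inj; first by rewrite tp ltr_norml; lra.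
have r0' : rC r != 0 by rewrite -mag_eq0 mag_rC normr_eq0 gt_eqF.
apply: (mulfI r0'); rewrite [RHS]qarg_polar //.
by rewrite magM mag_cis mulr1 mag_rC gtr0_norm.
Qed.

Lemma polar_exists (w : C) : exists2 x, 0 <= x <= pi *+ 2 & w = rC (mag w) * cis x.
Proof.
have P0 := pi_pos.
have [s [u [qu wE s4]]] : exists (s : nat) (u : C),
    [/\ quadrant u, w = 'i ^+ s * u & (s < 4)%N].
  have [r0|r0] := leP 0 (re w); have [i0|i0] := leP 0 (im w).
  - by exists 0%N, w; rewrite expr0 mul1r.
  - exists 3%N, ('i * w); rewrite mulrA -exprSr expr_i4 mul1r; split=> //.
    by split; rewrite !reimE; lra.
  - exists 1%N, (- ('i * w)); rewrite expr1 mulrN mulrA -expr2 sqrCi mulN1r opprK.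
    by split=> //; split; rewrite !reimE; lra.
  - exists 2%N, (- w); rewrite sqrCi mulrNN mul1r; split=> //.
    by split; rewrite !reimE; lra.
exists (qarg u + pi / 2 * s%:R).
  have a0 := qarg_ge0 qu; have a1 := qarg_le qu.
  have s0 : 0 <= s%:R :> R by rewrite ler0n.
  have s3 : s%:R <= 3 :> R by rewrite ler_nat.
  have : s%:R * pi <= 3 * pi :> R by rewrite ler_pM2r.
  have : 0 <= s%:R * pi :> R by rewrite mulr_ge0 // ltW.
  by rewrite tp; lra.
rewrite cisD cisX cis_pihalf wE magM mag_iX mul1r mulrA -qarg_polar //.
exact: mulrC.
Qed.

Lemma nat_cell (x : R) n : (0 < n)%N -> 0 <= x <= n%:R ->
  exists2 k, (k < n)%N & k%:R <= x <= k.+1%:R.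
Proof.
elim: n => // n IH _ /andP[x0 x1].
have [h|h] := leP x n%:R; last by exists n; rewrite // (ltW h).
have [n0|n0] := posnP n; last first.
  by have [|k kn kx] := IH n0; [rewrite x0 | exists k => //; apply: ltnW].
by exists 0%N => //; rewrite n0 in h; rewrite x0; lra.
Qed.

(** The point of angle [x] lies in the sector that contains [N * x]; both ends of
    a sector are allowed, so that the angle [2 * pi] needs no special case. *)
Lemma root_petal_surj (w : C) : exists k u,
  [/\ (k < 4 * N)%N, quadrant u & root_petal k u = w].
Proof.
have P0 := pi_pos.
have [x /andP[x0 x1] wE] := polar_exists w.
have [w0|w0] := eqVneq w 0.
  by exists 0%N, 0; split; rewrite ?muln_gt0 // w0 root_petal0.
have m0 : 0 < mag w by rewrite mag_gt0.
have [||k kN /andP[k0 k1]] := @nat_cell (x * N%:R / (pi / 2)) (4 * N).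
- by rewrite muln_gt0.
- apply/andP; split.
    by apply: divr_ge0; [rewrite mulr_ge0 | rewrite divr_ge0 // ltW].
  rewrite ler_pdivrMr ?divr_gt0 // natrM.
  have : x * N%:R <= pi *+ 2 * N%:R by rewrite ler_pM2r.
  by rewrite tp; lra.
have p2 : 0 < pi / 2 :> R by rewrite divr_gt0.
rewrite ler_pdivlMr // in k0; rewrite ler_pdivrMr // -natr1 mulrDl mul1r in k1.
pose y := x * N%:R - k%:R * (pi / 2).
have yI : 0 <= y <= pi / 2 by rewrite /y; lra.
exists k, (rC (mag w ^+ N) * cis y); split=> //.
  by apply: quadrant_polar => //; rewrite exprn_ge0 // ltW.
rewrite /root_petal qarg_unique ?exprn_gt0 // magM mag_cis mulr1 mag_rC.
rewrite ger0_norm ?exprn_ge0 ?mag_ge0 // powR_root ?mag_ge0 // /y subrK mulfK //.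
Qed.

End RootPetals.

(** * Complex derivatives *)

Section ComplexDerivative.
Variable R : realType.
Local Notation C := (Cplx R).

Lemma quotient_derivableP (f : C -> C) (z l : C) :
  (h^-1 * (f (h + z) - f z) @[h --> 0^'] --> l) <->
  derivable f z 1 /\ f^`()%classic z = l.
Proof.
have E : (fun h : C => h^-1 * (f (h + z) - f z)) =
         (fun h => h^-1 *: ((f \o shift z) (h *: 1) - f z)).
  by apply/funext => h /=; rewrite /shift /= /GRing.scale /= mulr1.
split=> [H|[H <-]].
  split; last exact: cvg_lim H.
  by apply/cvg_ex; exists l; rewrite -E.
by move: H; rewrite /derivable -E.
Qed.

Lemma cvg_sum_ord (F : set_system C) (FF : Filter F) n (f : nat -> C -> C)
    (l : nat -> C) :
  (forall i, f i x @[x --> F] --> l i) ->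
  \sum_(i < n) f i x @[x --> F] --> \sum_(i < n) l i.
Proof.
move=> H; elim: n => [|n IH].
  rewrite big_ord0 (_ : (fun x => _) = fun=> 0); first exact: cvg_cst.
  by apply/funext => x; rewrite big_ord0.
rewrite big_ord_recr /= (_ : (fun x => _) = fun x => \sum_(i < n) f i x + f n x).
  apply: (cvgD IH (H n)).
by apply/funext => x; rewrite big_ord_recr.
Qed.

Lemma cvg_exprn (F : set_system C) (FF : Filter F) (f : C -> C) (l : C) n :
  f x @[x --> F] --> l -> f x ^+ n @[x --> F] --> l ^+ n.
Proof.
move=> H; elim: n => [|n IH]; first by rewrite expr0; exact: cvg_cst.
rewrite exprS (_ : (fun x => _) = fun x => f x * f x ^+ n); first exact: (cvgM H IH).
by apply/funext => x; rewrite exprS.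
Qed.

(** A continuous [m]-th root of a differentiable function is differentiable
    wherever the power map is locally invertible: the difference quotient of
    [T ^ m] is that of [T] times [S h], which tends to [m * T z ^ (m - 1)]. *)
Lemma derivable_root m (T G : C -> C) (z : C) :
  (0 < m)%N -> {for z, continuous T} -> (\forall w \near z, T w ^+ m = G w) ->
  derivable G z 1 -> (m = 1%N \/ T z != 0) ->
  derivable T z 1 /\ G^`()%classic z = m%:R * T z ^+ m.-1 * T^`()%classic z.
Proof.
move=> m0 cT TG dG mT.
have shift0 : h + z @[h --> (0 : C)^'] --> z.
  have h0 : (h : C) @[h --> (0 : C)^'] --> (0 : C) by exact: cvg_within.
  have hz : (z : C) @[h --> (0 : C)^'] --> z by exact: cvg_cst.
  have : h + z @[h --> (0 : C)^'] --> (0 + z : C) by exact: (cvgD h0 hz).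
  by rewrite add0r.
pose S (h : C) := \sum_(i < m) T (h + z) ^+ (m.-1 - i) * T z ^+ i.
pose s : C := m%:R * T z ^+ m.-1.
have s0 : s != 0.
  rewrite mulf_neq0 ?pnatr_eq0 -?lt0n //.
  by case: mT => [->|T0]; rewrite ?expr0 ?oner_neq0 // expf_neq0.
have cS : S h @[h --> 0^'] --> s.
  have -> : s = \sum_(i < m) T z ^+ (m.-1 - i) * T z ^+ i.
    rewrite (eq_bigr (fun=> T z ^+ m.-1)) => [|i _].
      by rewrite sumr_const card_ord /s mulr_natl.
    by rewrite -exprD subnK // -ltnS prednK // ltn_ord.
  apply: (@cvg_sum_ord _ _ m (fun i h => T (h + z) ^+ (m.-1 - i) * T z ^+ i)
     (fun i => T z ^+ (m.-1 - i) * T z ^+ i)) => i.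
  have cTz : T (h + z) @[h --> (0 : C)^'] --> T z by exact: (cvg_comp _ _ shift0 cT).
  have cc : (T z ^+ i) @[h --> (0 : C)^'] --> T z ^+ i by exact: cvg_cst.
  exact: (cvgM (cvg_exprn _ cTz) cc).
have /quotient_derivableP qG : derivable G z 1 /\ G^`()%classic z = G^`()%classic z by [].
have Tz : T z ^+ m = G z by exact: nbhs_singleton TG.
have qT : h^-1 * (T (h + z) - T z) @[h --> (0 : C)^'] --> G^`()%classic z * s^-1.
  have : (h^-1 * (G (h + z) - G z)) * (S h)^-1 @[h --> (0 : C)^'] -->
      G^`()%classic z * s^-1.
    by exact: (cvgM qG (cvgV s0 cS)).
  apply: cvg_trans; apply: near_eq_cvg.
  have nS : \forall h \near (0 : C)^', S h != 0 by exact: cvgr_neq0 cS s0.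
  have nG : \forall h \near (0 : C)^', T (h + z) ^+ m = G (h + z) by exact: (shift0 _ TG).
  near=> h.
  have Sh : S h != 0 by near: h.
  have Gh : T (h + z) ^+ m = G (h + z) by near: h.
  rewrite -Gh -Tz subrXX /= -[X in _ * (_ * X)]/(S h) mulrA mulfK //.
have /quotient_derivableP[dT eT] := qT.
by split=> //; rewrite eT -/s mulrC mulfVK.
Unshelve. all: by end_near. Qed.

Lemma derivable_affine (a b : C) (z : C) :
  derivable (fun w : C => a * w + b) z 1 /\ (fun w : C => a * w + b)^`()%classic z = a.
Proof.
apply/quotient_derivableP.
apply: (@cvg_trans _ ((fun=> a) @ (0 : C)^')); last exact: cvg_cst.
apply: near_eq_cvg; near=> h.
have h0 : h != 0 by near: h; exact: nbhs_dnbhs_neq.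
by rewrite (_ : _ - _ = h * a) ?mulKf //; ring.
Unshelve. all: by end_near. Qed.

Lemma derivable_monomial (c : C) m (z : C) :
  derivable (fun w : C => w ^+ m + c) z 1 /\
  (fun w : C => w ^+ m + c)^`()%classic z = m%:R * z ^+ m.-1.
Proof.
have [->|m0] := posnP m.
  have [d e] := derivable_affine 0 (1 + c) z.
  have E : (fun w : C => w ^+ 0 + c) = (fun w : C => 0 * w + (1 + c)).
    by apply/funext => w; rewrite expr0 mul0r add0r.
  by rewrite E e mul0r.
have d : derivable (fun w : C => w ^+ m + c) z 1.
  by apply: derivableD; [exact: exprn_derivable | exact: derivable_cst].
split=> //; rewrite derive1E deriveD ?exp_derive ?derive_cst ?addr0.
- by rewrite /GRing.scale /= mulr1.
- exact: exprn_derivable.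
- exact: derivable_cst.
Qed.

End ComplexDerivative.

(** * The surface obtained by gluing the squares *)

Section SquareCompact.
Variable R : realType.
Local Notation C := (Cplx R).

Lemma unit_square_compact : compact (@unit_square R).
Proof.
pose f (p : R * R) : C := rC p.1 + 'i * rC p.2.
have cf : continuous f.
  move=> p; have c1 : {for p, continuous (fun p : R * R => rC p.1 : C)}.
    by apply: continuous_comp; [exact: cvg_fst | exact: continuous_rC].
  have c2 : {for p, continuous (fun p : R * R => rC p.2 : C)}.
    by apply: continuous_comp; [exact: cvg_snd | exact: continuous_rC].
  have ci : {for p, continuous (fun p : R * R => 'i : C)} by exact: cst_continuous.
  exact: (continuousD c1 (continuousM ci c2)).
have -> : @unit_square R = f @` (`[0, 1] `*` `[0, 1])%classic.
  apply/seteqP; split => [z /unit_squareE[a b c d]|z [[x y] /= []]].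
    exists (re z, im z) => /=; first by rewrite !in_itv /= a b c d.
    rewrite -[f _]/(rC (re z) + 'i * rC (im z)).
    by apply: plane_eq; rewrite !reimE; ring.
  rewrite !in_itv /= => /andP[a b] /andP[c d] <-; apply/unit_squareE.
  rewrite -[f _]/(rC x + 'i * rC y).
  by rewrite !reimE; split; lra.
apply: continuous_compact; first exact: continuous_subspaceT.
by apply: compact_setX; exact: segment_compact.
Qed.

Lemma plane_hausdorff : hausdorff_space C.
Proof. exact: norm_hausdorff. Qed.

Lemma unit_square_closed : closed (@unit_square R).
Proof. exact: (compact_closed plane_hausdorff unit_square_compact). Qed.

End SquareCompact.

Section Surface.
Variables (R : realType) (N : nat) (M : quad_mesh N).
Local Notation C := (Cplx R).

Let point : Type := ('I_N * C)%type.
Let glued : point -> point -> Prop := clos_refl_sym_trans _ (@side_glued R N M).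

(** Points of the plane outside the unit square are sent to a corner, so that
    the quotient below has no spurious points. *)
Definition to_square (z : C) : C := if `[< unit_square z >] then z else 0.

Lemma to_square_in z : unit_square (to_square z).
Proof.
rewrite /to_square; case: ifPn => [/asboolP //|_].
by rewrite -rC0; apply: unit_square_real; rewrite lexx ler01.
Qed.

Lemma to_square_id z : unit_square z -> to_square z = z.
Proof. by move=> hz; rewrite /to_square; case: asboolP. Qed.

Definition same_point (p p' : point) : bool :=
  `[< glued (p.1, to_square p.2) (p'.1, to_square p'.2) >].

Lemma same_point_refl : reflexive same_point.
Proof. by move=> p; apply/asboolP; apply: rst_refl. Qed.

Lemma same_point_sym : symmetric same_point.
Proof. by move=> p p'; apply/asboolP/asboolP; apply: rst_sym. Qed.

Lemma same_point_trans : transitive same_point.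
Proof.
by move=> p' p p'' /asboolP h /asboolP h'; apply/asboolP; apply: rst_trans h h'.
Qed.

Canonical same_point_equiv :=
  EquivRel same_point same_point_refl same_point_sym same_point_trans.

Definition surface : Type := {eq_quot same_point_equiv}%qT.

HB.instance Definition _ := Choice.on surface.

Definition square_map (f : 'I_N) (z : C) : surface :=
  \pi_({eq_quot same_point_equiv}%qT)%qT (f, z).

Lemma square_mapP f h z z' : unit_square z -> unit_square z' ->
  square_map f z = square_map h z' <-> glued (f, z) (h, z').
Proof.
move=> hz hz'; split=> [/eqmodP /asboolP /=|H]; first by rewrite !to_square_id.
by apply/eqmodP/asboolP; rewrite /= !to_square_id.
Qed.

Lemma square_map_onto (x : surface) :
  exists f z, unit_square z /\ square_map f z = x.
Proof.
exists (repr x).1, (to_square (repr x).2); split; first exact: to_square_in.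
rewrite -[RHS]reprK; apply/eqmodP/asboolP => /=.
by rewrite (to_square_id (to_square_in _)); apply: rst_refl.
Qed.

(** The final topology for the maps of the closed squares. It makes these maps
    continuous and every test of openness local in a single square. *)
Definition surface_open (U : set surface) : Prop :=
  forall f z, unit_square z -> U (square_map f z) ->
  \forall w \near z, unit_square w -> U (square_map f w).

Lemma surface_openT : surface_open setT.
Proof. by move=> f z _ _; near do by []. Unshelve. all: by end_near. Qed.

Lemma surface_openI : setI_closed surface_open.
Proof.
move=> U V oU oV f z hz [Uz Vz]; near=> w => hw; split; move: hw; near: w.
  exact: oU.
exact: oV.
Unshelve. all: by end_near. Qed.

Lemma surface_open_bigU (I : Type) (U : I -> set surface) :
  (forall i, surface_open (U i)) -> surface_open (\bigcup_i U i).
Proof.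
move=> oU f z hz [i _ Uz]; near=> w => hw; exists i => //; move: hw; near: w.
exact: oU.
Unshelve. all: by end_near. Qed.

HB.instance Definition _ := isOpenTopological.Build surface
  surface_openT surface_openI surface_open_bigU.

Lemma surface_openE (U : set surface) : open U = surface_open U.
Proof. by []. Qed.

(** Continuity can be checked upstairs, square by square. *)
Lemma surface_continuous (T : topologicalType) (g : surface -> T) (D : set surface) :
  open D ->
  (forall f z, unit_square z -> D (square_map f z) ->
     forall V, open V -> V (g (square_map f z)) ->
     \forall w \near z, unit_square w -> V (g (square_map f w))) ->
  forall x, D x -> {for x, continuous g}.
Proof.
move=> oD H x Dx V /=; rewrite nbhsE => -[V' [oV' V'x] sV].
suff H' : nbhs x (g @^-1` V') by apply: (filterS _ H') => y /sV.
suff : open_nbhs x (D `&` g @^-1` V').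
  by move/open_nbhs_nbhs; apply: filterS => y [].
split=> //; rewrite surface_openE => f z hz [Dz Vz]; near=> w => hw; split.
  by move: hw; near: w; move: oD; rewrite surface_openE; apply.
by move: hw; near: w; apply: H.
Unshelve. all: by end_near. Qed.

Lemma square_map_within f : {within @unit_square R, continuous (square_map f)}.
Proof.
apply/subspace_continuousP => z hz V; rewrite nbhsE => -[V' [oV' V'x] sV].
have H : nbhs z (fun w => unit_square w -> V' (square_map f w)).
  by move: oV'; rewrite surface_openE; apply.
by apply: filterS H => w Hw hw; apply: sV; exact: Hw.
Qed.

Lemma surface_compact : compact [set: surface].
Proof.
have -> : [set: surface] =
    \big[setU/set0]_(f : 'I_N) (square_map f @` @unit_square R).
  apply/seteqP; split=> // x _; have [f [z [hz <-]]] := square_map_onto x.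
  by rewrite -bigcup_seq; exists f; [exact: mem_index_enum | exists z].
apply: bigsetU_compact => f _; apply: continuous_compact.
  exact: square_map_within.
exact: unit_square_compact.
Qed.

(** All squares contain one corner in common, to which every point is joined by
    a segment. *)
Lemma surface_connected (v : surface) :
  (forall f, square_map f 0 = v) -> connected [set: surface].
Proof.
move=> Hv.
pose seg (p : 'I_N * C) : set surface :=
  (fun x : R => square_map p.1 (rC x * p.2)) @` `[0, 1]%classic.
have -> : [set: surface] = \bigcup_(p in [set p : 'I_N * C | unit_square p.2]) seg p.
  apply/seteqP; split=> // x _; have [f [z [hz <-]]] := square_map_onto x.
  exists (f, z) => //; exists 1; first by rewrite /= in_itv /= lexx ler01.
  by rewrite rC1 mul1r.
apply: bigcup_connected => [|[f z] /= hz].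
  exists v => -[f z] _; exists 0; first by rewrite /= in_itv /= lexx ler01.
  by rewrite /= rC0 mul0r.
rewrite /seg /=; apply: connected_continuous_connected; first exact: segment_connected.
have sq x : 0 <= x <= 1 -> unit_square (rC x * z).
  move=> /andP[x0 x1]; move: hz => /unit_squareE[a b c d]; apply/unit_squareE.
  by rewrite !reimE !mul0r subr0 addr0; split; rewrite ?mulr_ge0 ?mulr_ile1.
apply/subspace_continuousP => x /=; rewrite in_itv /= => xI V.
rewrite nbhsE => -[V' [oV' V'x] sV].
have : \forall w \near (rC x * z), unit_square w -> V' (square_map f w).
  exact: ((oV' : surface_open V') f _ (sq _ xI) V'x).
have cx : {for x, continuous (fun x : R => rC x * z : C)}.
  have c1 : {for x, continuous (fun x : R => rC x : C)} by exact: continuous_rC.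
  have c2 : {for x, continuous (fun x : R => z : C)} by exact: cst_continuous.
  exact: (continuousM c1 c2).
move=> /cx H.
have {}H : nbhs x (fun y : R => unit_square (rC y * z) -> V' (square_map f (rC y * z))).
  exact: H.
suff : nbhs x (fun y : R => `[0, 1]%classic y -> V (square_map f (rC y * z))) by [].
apply: filterS H => y Hy; rewrite /= in_itv /= => yI.
exact: sV (Hy (sq _ yI)).
Qed.

End Surface.

(** * Petal charts *)

Section PetalCharts.
Variables (R : realType) (N : nat) (M : quad_mesh N) (dir : 'I_N -> Cplx R).
Hypothesis mag_dir : forall f, mag (dir f) = 1.
Local Notation C := (Cplx R).
Local Notation surf := (surface R M).
Local Notation q := (@square_map R N M).
Local Notation glued := (clos_refl_sym_trans _ (@side_glued R N M)).

(** A chart around a point of the surface that lies on several squares, or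
    several times on the same square. Each occurrence is the centre of a petal,
    the part of a square in a disc of radius [petal_rad]. The coordinate
    [petal_map] is an [m]-th root of the developing map of the squares turned by
    [dir], where [m] is [petal_deg]. Compatibility with the gluing
    ([petal_map_glue]) makes it a function on the surface, and [petal_map_inj]
    makes that function injective. *)
Record petal_chart := PetalChart {
  petal : finType;
  petal_square : petal -> 'I_N;
  petal_ctr : petal -> C;
  petal_rad : R;
  petal_deg : nat;
  petal_map : petal -> C -> C;
  in_petal := fun (p : petal) (z : C) =>
    unit_square z /\ mag (z - petal_ctr p) < petal_rad;
  petal_deg_gt0 : (0 < petal_deg)%N;
  petal_disjoint : forall p p' z, petal_square p = petal_square p' ->
    in_petal p z -> in_petal p' z -> p = p';
  petal_mapX : forall p z, in_petal p z ->
    petal_map p z ^+ petal_deg = dir (petal_square p) * (z - petal_ctr p);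
  petal_map_cont : forall p z, in_petal p z -> {for z, continuous (petal_map p)};
  petal_map_inj : forall p p' z z', in_petal p z -> in_petal p' z' ->
    petal_map p z = petal_map p' z' ->
    glued (petal_square p, z) (petal_square p', z');
  petal_map_glue : forall p (d : dart N) x, 0 <= x <= 1 -> petal_square p = d.1 ->
    in_petal p (side_point d.2 (rC x)) ->
    exists p', [/\ petal_square p' = (M d).1,
      in_petal p' (side_point (M d).2 (rC (1 - x))) &
      petal_map p' (side_point (M d).2 (rC (1 - x))) =
      petal_map p (side_point d.2 (rC x))];
  petal_map_surj : forall w, mag w ^+ petal_deg < petal_rad ->
    exists p z, in_petal p z /\ petal_map p z = w }.

Variable P : petal_chart.
Local Notation m := (petal_deg P).
Local Notation r := (petal_rad P).
Local Notation sq := (@petal_square P).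
Local Notation F := (@petal_map P).
Local Notation ctr p := (@petal_ctr P p).

(** The coordinate of a point of the surface, as a relation; it is functional
    and injective. *)
Definition coord (x : surf) (w : C) : Prop :=
  exists p z, [/\ in_petal p z, q (sq p) z = x & F p z = w].

Lemma mag_petal (p : petal P) z : in_petal p z -> mag (F p z) ^+ m = mag (z - ctr p).
Proof. by move=> h; rewrite -magX (petal_mapX h) magM mag_dir mul1r. Qed.

Lemma coord_lt x w : coord x w -> mag w ^+ m < r.
Proof. by move=> [p [z [h _ <-]]]; rewrite mag_petal //; case: h. Qed.

(** The relation [coord] on points of squares; it is invariant under gluing, which
    needs to be checked for a single gluing step only. *)
Let up (a : 'I_N * C) (w : C) : Prop :=
  exists p, [/\ sq p = a.1, in_petal p a.2 & F p a.2 = w].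

Lemma side_glued_sym (a b : 'I_N * C) : side_glued M a b -> side_glued M b a.
Proof.
case=> d t t01; have := @SideGlued R N M (M d) (1 - t).
rewrite glueK subKr; apply.
by case/andP: t01 => t0 t1; rewrite subr_ge0 t1 lerBlDr lerDl.
Qed.

Lemma side_glued_up a b w : side_glued M a b -> up a w -> up b w.
Proof.
case=> d t /unit_param[x -> x01] [p [/= sp inp <-]].
have [p' [sp' inp' <-]] := petal_map_glue x01 sp inp.
by exists p'; rewrite /= -rC1 -rCN -rCD.
Qed.

Lemma glued_up a b w : glued a b -> up a w <-> up b w.
Proof.
elim=> {a b} [a b ab|a|a b _ IH|a b c _ IH _ IH'] //.
- by split; apply: side_glued_up => //; apply: side_glued_sym.
- by split=> /IH.
- by rewrite IH.
Qed.

Lemma coord_square f z w : unit_square z ->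
  coord (q f z) w <-> exists p, [/\ sq p = f, in_petal p z & F p z = w].
Proof.
move=> hz; split=> [[p [z' [inp /square_mapP E Fw]]]|[p [<- inp Fw]]].
  have /E G := inp.1.
  have : up (sq p, z') w by exists p.
  by move/(glued_up w (G hz)).
by exists p, z.
Qed.

Lemma coord_petal (p : petal P) z : in_petal p z -> coord (q (sq p) z) (F p z).
Proof. by move=> h; exists p, z. Qed.

Lemma coord_fun x w w' : coord x w -> coord x w' -> w = w'.
Proof.
have [f [z [hz <-]]] := square_map_onto x.
rewrite !coord_square // => -[p [sp inp <-]] [p' [sp' inp' <-]].
by have -> : p = p' by apply: petal_disjoint inp inp'; rewrite sp.
Qed.

Lemma coord_inj x x' w : coord x w -> coord x' w -> x = x'.
Proof.
move=> [p [z [inp <- <-]]] [p' [z' [inp' <- E]]].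
apply/square_mapP; [exact: inp.1 | exact: inp'.1 |].
exact: petal_map_inj.
Qed.

Definition petal_dom : set surf := [set x | exists w, coord x w].
Definition petal_cod : set C := [set w | mag w ^+ m < r].
Definition to_coord (x : surf) : C := xget 0 [set w | coord x w].

Lemma to_coordP x : petal_dom x -> coord x (to_coord x).
Proof. by move=> [w xw]; rewrite /to_coord; case: xgetP => [y _ //|/(_ w)]. Qed.

Lemma to_coordE x w : coord x w -> to_coord x = w.
Proof. by move=> xw; exact: (coord_fun (to_coordP (ex_intro _ w xw)) xw). Qed.

Variable base : surf.
Definition of_coord (w : C) : surf := xget base [set x | coord x w].

Lemma of_coordP w : petal_cod w -> coord (of_coord w) w.
Proof.
move=> /petal_map_surj[p [z [inp E]]]; rewrite /of_coord.
case: xgetP => [y _ //|/(_ (q (sq p) z)) []].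
by rewrite -E; apply: coord_petal.
Qed.

Lemma of_coordE x w : coord x w -> of_coord w = x.
Proof. by move=> xw; exact: (coord_inj (of_coordP (coord_lt xw)) xw). Qed.

Lemma near_in_petal (p : petal P) z : in_petal p z ->
  \forall w \near z, unit_square w -> in_petal p w.
Proof.
move=> [_ h]; apply/near_magP; exists (r - mag (z - ctr p)); first by rewrite subr_gt0.
move=> w hw hsq; split=> //.
have -> : w - ctr p = (z - ctr p) - (z - w) by ring.
by have := magD (z - ctr p) (- (z - w)); rewrite magN; lra.
Qed.

Lemma petal_dom_open : open petal_dom.
Proof.
rewrite surface_openE => f z hz [v /coord_square-/(_ hz)[p [<- inp _]]].
have := near_in_petal inp; apply: filterS => w H hw.
by exists (F p w); apply: coord_petal; apply: H.
Qed.

Lemma petal_cod_open : open petal_cod.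
Proof.
have -> : petal_cod = (fun w : C => mag w ^+ m) @^-1` [set x | x < r] by [].
apply: open_comp => [w _|]; last exact: open_lt.
apply: (@continuous_comp _ _ _ (@mag R) (fun x : R => x ^+ m)).
  exact: continuous_mag.
exact: exprn_continuous.
Qed.

Lemma to_coord_cont x : petal_dom x -> {for x, continuous to_coord}.
Proof.
apply: surface_continuous x; first exact: petal_dom_open.
move=> f z hz [v /coord_square-/(_ hz)[p [<- inp _]]] V oV.
rewrite (to_coordE (coord_petal inp)) => Vz.
have nV : \forall w \near z, V (F p w).
  by apply: (petal_map_cont inp); apply: open_nbhs_nbhs.
apply: (filterS2 (nbhs_filter z) _ nV (near_in_petal inp)) => w Vw H hw.
by rewrite (to_coordE (coord_petal (H hw))).
Qed.

(** If [of_coord] were discontinuous at [w], then [w] would be the image of a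
    point outside [U] by compactness of the closed petals of radius [rho]. *)
Lemma of_coord_cont w : petal_cod w -> {for w, continuous of_coord}.
Proof.
move=> cw; have xw := of_coordP cw; set x := of_coord w in xw.
move=> V; rewrite nbhsE => -[U [oU Ux] sUV].
pose rho := (mag w ^+ m + r) / 2.
have cw' : mag w ^+ m < r := cw.
pose K (p : petal P) : set C := [set z | [/\ unit_square z, mag (z - ctr p) <= rho & ~ U (q (sq p) z)]].
have Kin p z : K p z -> in_petal p z.
  by move=> [hz hr _]; split=> //; apply: le_lt_trans hr _; rewrite /rho; lra.
have Kcl p : closed (K p).
  have -> : K p = @unit_square R `&` ([set z | mag (z - ctr p) <= rho] `&`
      ~` [set z | nbhs z (fun v => unit_square v -> U (q (sq p) v))]).
    apply/seteqP; split=> z.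
      by move=> [hz hr nU]; split=> //; split=> // H; apply: nU; exact: (nbhs_singleton H).
    move=> [hz [hr nH]]; split=> // Uz; apply: nH.
    exact: ((oU : surface_open U) _ _ hz Uz).
  apply: closedI; first exact: unit_square_closed.
  apply: closedI.
    have -> : [set z | mag (z - ctr p) <= rho] =
       (fun z : C => mag (z - ctr p)) @^-1` [set y | y <= rho] by [].
    apply: closed_comp => [z _|]; last exact: closed_le.
    apply: (@continuous_comp _ _ _ (fun z : C => z - ctr p) (@mag R)).
      have c1 : {for z, continuous (fun z : C => z)} by exact: cvg_id.
      have c2 : {for z, continuous (fun _ : C => ctr p)} by exact: cst_continuous.
      exact: (continuousB c1 c2).
    exact: continuous_mag.
  apply: open_closedC; rewrite openE => z /= H; exact: nbhs_interior.
have Kim p : closed (F p @` K p).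
  apply: (compact_closed (@plane_hausdorff R)); apply: continuous_compact.
    apply: continuous_in_subspaceT => z; rewrite inE => /Kin.
    exact: petal_map_cont.
  by apply: subclosed_compact (@unit_square_compact R) _ => // z [].
have nK p : \forall v \near w, ~ (F p @` K p) v.
  apply: open_nbhs_nbhs; split; first exact: closed_openC.
  move=> [z Kz Fz]; have [_ _] := Kz; apply.
  have xz : coord (q (sq p) z) w by rewrite -Fz; apply: coord_petal; apply: Kin.
  by rewrite (coord_inj xz xw).
have nr : \forall v \near w, mag v ^+ m < rho.
  have : {for w, continuous (fun v : C => mag v ^+ m)}.
    apply: (@continuous_comp _ _ _ (@mag R) (fun x : R => x ^+ m)).
      exact: continuous_mag.
    exact: exprn_continuous.
  move=> cm; apply: (cm [set y | y < rho]); apply: open_nbhs_nbhs.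
  split; first exact: open_lt.
  by rewrite /= /rho; lra.
have nK' : \forall v \near w, forall p, ~ (F p @` K p) v.
  exact: (filter_forall (nbhs_filter w) nK).
suff : nbhs w (of_coord @^-1` V) by [].
apply: (filterS2 (nbhs_filter w) _ nK' nr) => v Kv vr; apply: sUV.
have cv : petal_cod v by apply: lt_trans vr _; rewrite /rho; lra.
have [p [z [inp <- Fz]]] := of_coordP cv.
apply: contrapT => nU; apply: (Kv p); exists z => //.
by split=> //; [exact: inp.1 | rewrite -(mag_petal inp) Fz ltW].
Qed.

Definition chart_of_petals : chart R surf := {|
  cdom := petal_dom; ccod := petal_cod; cmap := to_coord; cinv := of_coord;
  cdom_open := petal_dom_open;
  ccod_open := petal_cod_open;
  cmap_cod := fun x dx => coord_lt (to_coordP dx);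
  cinv_dom := fun w cw => ex_intro _ w (of_coordP cw);
  cmapK := fun x dx => of_coordE (to_coordP dx);
  cinvK := fun w cw => to_coordE (of_coordP cw);
  cmap_cont := to_coord_cont;
  cinv_cont := of_coord_cont |}.

(** Smaller closed discs are closed in the surface; this separates the points of
    the chart from those outside it. *)
Lemma petal_far_open rho : rho < r ->
  open [set x : surf | ~ exists2 w, coord x w & mag w ^+ m <= rho].
Proof.
move=> rr; rewrite surface_openE => f z hz nz.
have near_p (p : petal P) : \forall v \near z, unit_square v -> sq p = f ->
    in_petal p v -> rho < mag (F p v) ^+ m.
  have [sp|sp] := pselect (sq p = f); last by near do by [].
  have [h|h] := ltP rho (mag (z - ctr p)).
    apply/near_magP; exists (mag (z - ctr p) - rho); first by rewrite subr_gt0.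
    move=> v hv _ _ inp; rewrite (mag_petal inp).
    have := magD (v - ctr p) (z - v).
    have -> : v - ctr p + (z - v) = z - ctr p by ring.
    lra.
  exfalso; apply: nz; have inp : in_petal p z by split=> //; apply: le_lt_trans rr.
  exists (F p z); last by rewrite mag_petal.
  by rewrite -sp; apply: coord_petal.
have : \forall v \near z, forall p : petal P, unit_square v -> sq p = f ->
    in_petal p v -> rho < mag (F p v) ^+ m.
  exact: (filter_forall (nbhs_filter z) near_p).
apply: filterS => v H hv [w /coord_square-/(_ hv)[p [sp inp <-]]].
by rewrite leNgt H.
Unshelve. all: by end_near. Qed.

End PetalCharts.

(** * The Riemann surface and the form of a petal atlas *)

Section PetalAtlas.
Variables (R : realType) (N : nat) (M : quad_mesh N) (dir : 'I_N -> Cplx R).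
Hypothesis mag_dir : forall f, mag (dir f) = 1.
Local Notation C := (Cplx R).
Local Notation surf := (surface R M).
Local Notation q := (@square_map R N M).

Variables (I : Type) (P : I -> petal_chart M dir) (base : surf).
Hypothesis covered : forall x, exists i, petal_dom (P i) x.
Hypothesis surf_connected : connected [set: surf].
Hypothesis branch_centre : forall i j x, petal_deg (P j) <> 1%N ->
  coord (P j) x 0 -> petal_dom (P i) x -> i = j.

Local Notation m i := (petal_deg (P i)).

(** Two points of a chart are separated by their coordinates. A point of the
    chart is separated from a point outside by an intermediate radius. *)
Lemma surf_hausdorff : hausdorff_space surf.
Proof.
rewrite open_hausdorff => x y /eqP xy.
have [i dx] := covered x.
have cx := to_coordP dx; set w := to_coord (P i) x in cx.
have [dy|dy] := pselect (petal_dom (P i) y).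
  have cy := to_coordP dy; set v := to_coord (P i) y in cy.
  have wv : w != v by apply/eqP => E; apply: xy; rewrite -E in cy; exact: coord_inj cx cy.
  have := @plane_hausdorff R; rewrite open_hausdorff => /(_ _ _ wv).
  move=> [[A B] /= [wA vB] [oA oB /eqP AB]].
  have op U : open U -> open (petal_dom (P i) `&` to_coord (P i) @^-1` U).
    move=> oU; rewrite openE => z [dz Uz]; apply: filterI.
      by apply: open_nbhs_nbhs; split=> //; apply: petal_dom_open.
    have cz : {for z, continuous (to_coord (P i))} by apply: to_coord_cont.
    have UU : nbhs (to_coord (P i) z) U by apply: open_nbhs_nbhs.
    exact: (cz _ UU).
  exists (petal_dom (P i) `&` to_coord (P i) @^-1` A,
          petal_dom (P i) `&` to_coord (P i) @^-1` B) => /=.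
    by split; rewrite inE; split=> //; [move: wA | move: vB]; rewrite inE.
  split; [exact: op | exact: op |].
  apply/eqP/seteqP; split=> z //= [[_ Az] [_ Bz]].
  have : (A `&` B) (to_coord (P i) z) by [].
  by rewrite AB.
have wr := coord_lt mag_dir cx.
pose rho := (mag w ^+ m i + petal_rad (P i)) / 2.
have rr : rho < petal_rad (P i) by rewrite /rho; lra.
exists (petal_dom (P i) `&` to_coord (P i) @^-1` [set v | mag v ^+ m i < rho],
   [set y | ~ exists2 w, coord (P i) y w & mag w ^+ m i <= rho]) => /=.
  split; rewrite inE; first by split=> //; rewrite /= -/w /rho; lra.
  by move=> [v cv _]; apply: dy; exists v.
split.
- rewrite openE => z [dz Uz]; apply: filterI.
    by apply: open_nbhs_nbhs; split=> //; apply: petal_dom_open.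
  have cz : {for z, continuous (to_coord (P i))} by apply: to_coord_cont.
  suff oV : open [set v : C | mag v ^+ m i < rho].
    have UU : nbhs (to_coord (P i) z) [set v : C | mag v ^+ m i < rho].
      by apply: open_nbhs_nbhs.
    exact: (cz _ UU).
  have -> : [set v : C | mag v ^+ m i < rho] =
     (fun w : C => mag w ^+ m i) @^-1` [set x | x < rho] by [].
  apply: open_comp => [v _|]; last exact: open_lt.
  apply: (@continuous_comp _ _ _ (@mag R) (fun x : R => x ^+ m i)).
    exact: continuous_mag.
  exact: exprn_continuous.
- exact: petal_far_open.
- apply/eqP/seteqP; split=> z //= [[dz Az] nz]; apply: nz.
  by exists (to_coord (P i) z); [exact: to_coordP | exact: ltW].
Qed.

(** In all charts, the [m]-th power of the coordinate is a developing map of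
    the flat structure: any two of them differ by a locally constant function.
    In the final topology it suffices that the difference is constant near each
    point within each square, where it is a difference of translations. *)
Lemma developing_locally_constant i j x :
  petal_dom (P i) x -> petal_dom (P j) x ->
  \forall y \near x, to_coord (P j) y ^+ m j =
    to_coord (P i) y ^+ m i + (to_coord (P j) x ^+ m j - to_coord (P i) x ^+ m i).
Proof.
move=> dix djx; set c := _ - _.
pose U : set surf := [set y | [/\ petal_dom (P i) y, petal_dom (P j) y &
   to_coord (P j) y ^+ m j = to_coord (P i) y ^+ m i + c]].
suff oU : open U.
  have : nbhs x U.
    by apply: open_nbhs_nbhs; split=> //; split=> //; rewrite /c addrC subrK.
  by apply: filterS => y [].
rewrite surface_openE => f z hz [[v /coord_square-/(_ hz)[p [sp inp _]]]].
move=> [v' /coord_square-/(_ hz)[p' [sp' inp' _]]].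
have E p0 w (k : I) (s : petal (P k)) : petal_square s = p0 -> in_petal s w ->
    to_coord (P k) (q p0 w) ^+ m k = dir p0 * (w - petal_ctr s).
  by move=> <- h; rewrite (to_coordE (coord_petal h)) petal_mapX.
rewrite (E _ _ _ _ sp inp) (E _ _ _ _ sp' inp') => Ez.
apply: (filterS2 (nbhs_filter z) _ (near_in_petal inp) (near_in_petal inp')) => w H H' hw.
split.
- by exists (petal_map p w); rewrite -sp; apply: coord_petal; apply: H.
- by exists (petal_map p' w); rewrite -sp'; apply: coord_petal; apply: H'.
- rewrite (E _ _ _ _ sp (H hw)) (E _ _ _ _ sp' (H' hw)).
  have -> : dir f * (w - petal_ctr p') =
      dir f * (z - petal_ctr p') + dir f * (w - z) by ring.
  by rewrite Ez; ring.
Qed.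

Definition atlas (i : I) : chart R surf := chart_of_petals mag_dir (P i) base.

Definition atlas_form (i : I) (w : C) : C := (m i)%:R * w ^+ (m i).-1.

Lemma branch_or_not i x w : coord (P i) x w ->
  m i = 1%N \/ w != 0 \/ forall j, petal_dom (P j) x -> j = i.
Proof.
move=> cx; have [->|m1] := eqVneq (m i) 1%N; first by left.
right; have [w0|w0] := eqVneq w 0; last by left.
by right=> j; apply: branch_centre; [apply/eqP | rewrite -w0].
Qed.

(** At the centre of a branched chart the only coordinate change is the identity;
    elsewhere it is a root of [w ^ m + c]. *)
Lemma transition_derivable i j z :
  ccod (atlas i) z -> cdom (atlas j) (cinv (atlas i) z) ->
  let T := transition (atlas i) (atlas j) in
  derivable T z 1 /\ atlas_form i z = atlas_form j (T z) * T^`()%classic z.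
Proof.
move=> cz dj T; have cx := of_coordP base cz.
have cont_of := of_coord_cont mag_dir (base := base) cz.
set x := cinv (atlas i) z in dj cx.
have Tz : coord (P j) x (T z) by exact: to_coordP.
have cT : {for z, continuous T}.
  by apply: (continuous_comp cont_of); apply: to_coord_cont.
have [h|h] : (m j = 1%N \/ T z != 0) \/ i = j.
  have di : petal_dom (P i) x by exists z.
  by have [|[|/(_ i di)]] := branch_or_not Tz; [left; left | left; right | right].
- have dix : petal_dom (P i) x by exists z.
  have near_cod : \forall w \near z, petal_cod (P i) w.
    by apply: open_nbhs_nbhs; split=> //; apply: petal_cod_open.
  have [c Tm] : exists c : C, \forall w \near z, T w ^+ m j = w ^+ m i + c.
    exists (to_coord (P j) x ^+ m j - to_coord (P i) x ^+ m i).
    have := cont_of _ (developing_locally_constant dix dj).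
    apply: (filterS2 (nbhs_filter z) _ near_cod) => w cw /= ->.
    by rewrite (to_coordE (of_coordP base cw)).
  have [dG eG] := derivable_monomial c (m i) z.
  have [dT eT] := derivable_root (petal_deg_gt0 (P j)) cT Tm dG h.
  by split=> //; rewrite /atlas_form -eG eT.
- have near_id : \forall w \near z, T w ^+ 1 = w.
    have near_cod : \forall w \near z, petal_cod (P i) w.
      by apply: open_nbhs_nbhs; split=> //; apply: petal_cod_open.
    apply: filterS near_cod => w cw; rewrite expr1 /T -h.
    exact: (to_coordE (of_coordP base cw)).
  have [dG eG] := derivable_affine 1 0 z.
  have Tm : \forall w \near z, T w ^+ 1 = 1 * w + 0.
    by apply: filterS near_id => w ->; rewrite mul1r addr0.
  have [dT eT] := derivable_root (isT : (0 < 1)%N) cT Tm dG (or_introl erefl).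
  split=> //; have Tz1 : T z = z by have := nbhs_singleton near_id; rewrite expr1.
  move: eT; rewrite eG expr0 !mul1r => <-.
  by rewrite Tz1 -h mulr1.
Qed.

Definition petal_surface : compact_riemann_surface R := {|
  rs_space := surf; rs_index := I; rs_chart := atlas;
  rs_cover := covered;
  rs_holo := fun i j z cz dz => (transition_derivable cz dz).1;
  rs_hausdorff := surf_hausdorff;
  rs_connected := surf_connected;
  rs_compact := @surface_compact R N M |}.

Lemma atlas_form_derivable i z : derivable (atlas_form i) z 1.
Proof. by apply: derivableM; [exact: derivable_cst | exact: exprn_derivable]. Qed.

Definition petal_form : holomorphic_form petal_surface :=
  @HolomorphicForm R petal_surface atlas_form
    (fun i z _ => @atlas_form_derivable i z)
    (fun i j z cz dz => (transition_derivable cz dz).2).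

Lemma petal_surface_realization : @mesh_realization R N M petal_surface q.
Proof.
split; first exact: square_map_within.
- exact: square_map_onto.
- by move=> f h z z' hz hz'; apply: square_mapP.
Qed.

Hypothesis dir_turn : forall f, exists k : nat, dir f = 'i ^+ k.
Hypothesis branch_boundary : forall i (p : petal (P i)),
  m i <> 1%N -> ~ open_unit_square (petal_ctr p).

Lemma near_open_square (z : C) : open_unit_square z ->
  \forall w \near z, unit_square w.
Proof.
move=> /open_unit_squareE[a b c d].
pose e := Num.min (Num.min (re z) (1 - re z)) (Num.min (im z) (1 - im z)).
apply/near_magP; exists e; first by rewrite !lt_min !subr_gt0 a b c d.
move=> w; rewrite !lt_min => /andP[/andP[h1 h2] /andP[h3 h4]].
have := mag_ge_re (z - w); have := mag_ge_im (z - w); rewrite !reimE !ler_norml.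
by move=> /andP[? ?] /andP[? ?]; apply/unit_squareE; split; lra.
Qed.

(** Inside a square the coordinate is a root of a translation composed with the
    rotation by [dir f]. *)
Lemma petal_form_flat : @squares_flat R N petal_surface petal_form q.
Proof.
move=> f; have [k dk] := dir_turn f; exists k => z hz i dz phi.
have sz : unit_square z by exact: (nbhs_singleton (near_open_square hz)).
have cq : {for z, continuous (q f)}.
  move=> V; rewrite nbhsE => -[V' [oV' V'x] sV].
  have H := (oV' : surface_open V') f z sz V'x.
  suff : nbhs z (q f @^-1` V) by [].
  by apply: (filterS2 (nbhs_filter z) _ (near_open_square hz) H) => w hw /(_ hw)/sV.
have cphi : {for z, continuous phi}.
  by apply: (continuous_comp cq); apply: to_coord_cont.
have [v /coord_square-/(_ sz)[p [sp inp _]]] := dz.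
have near_p : \forall w \near z, in_petal p w.
  by apply: (filterS2 (nbhs_filter z) _ (near_open_square hz) (near_in_petal inp)) => w hw; apply.
have phiE w : in_petal p w -> phi w = petal_map p w.
  by move=> h; rewrite /phi /= -sp; apply: to_coordE; apply: coord_petal.
have phiX : \forall w \near z, phi w ^+ m i = dir f * w + - (dir f * petal_ctr p).
  by apply: filterS near_p => w h; rewrite phiE // petal_mapX // sp mulrBr.
have nb : m i = 1%N \/ phi z != 0.
  have [->|m1] := eqVneq (m i) 1%N; [by left | right].
  apply/eqP => p0; apply: (@branch_boundary i p); first by apply/eqP.
  have E : mag (z - petal_ctr p) = 0.
    rewrite -(mag_petal mag_dir inp) -phiE // p0.
    have -> : mag (0 : C) = 0 by apply/eqP; rewrite mag_eq0.
    by rewrite expr0n eqn0Ngt petal_deg_gt0.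
  by move/eqP: E; rewrite mag_eq0 subr_eq0 => /eqP <-.
have [dG eG] := derivable_affine (dir f) (- (dir f * petal_ctr p)) z.
have [dT eT] := derivable_root (petal_deg_gt0 (P i)) cphi phiX dG nb.
by split=> //; rewrite -dk -eG eT.
Qed.

Lemma petal_form_single_zero i0 x0 : m i0 <> 1%N ->
  (forall i, i <> i0 -> m i = 1%N) -> coord (P i0) x0 0 ->
  single_zero_of_order petal_form (m i0).-1.
Proof.
move=> m1 other cx0; exists x0; split.
  move=> i dx z0.
  have E : i = i0 by apply: branch_centre m1 cx0 dx.
  have z00 : z0 = 0 by rewrite /z0 /= E; apply: to_coordE.
  exists (fun=> (m i0)%:R); split.
  - by rewrite pnatr_eq0 -lt0n petal_deg_gt0.
  - by near do exact: derivable_cst.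
  - by near=> z; rewrite z00 subr0 /= /atlas_form E mulrC.
move=> y yx i dy z0; exists (atlas_form i); split.
- rewrite /atlas_form mulf_neq0 ?pnatr_eq0 -?lt0n ?petal_deg_gt0 //.
  have [E|ne] := pselect (i = i0); last by rewrite (other _ ne) expr0 oner_neq0.
  rewrite expf_neq0 //; apply/eqP => z00; apply: yx.
  have cy : coord (P i) y z0 by exact: to_coordP.
  by subst i; rewrite z00 in cy; exact: coord_inj cy cx0.
- by near do exact: atlas_form_derivable.
- by near=> z; rewrite expr0 mul1r.
Unshelve. all: by end_near. Qed.

End PetalAtlas.

(** * Charts of a one-vertex mesh with trivial holonomy *)

Section TranslationMesh.
Variables (R : realType) (N : nat) (M : quad_mesh N) (th : 'I_N -> 'Z_4).
Hypothesis rotationE : forall d, rotation M d = th (M d).1 - th d.1.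
Hypothesis one_orbit : forall d e, fconnect (vertex_perm M) d e.
Variable d0 : dart N.
Hypothesis d0_turn : th d0.1 = d0.2.
Local Notation C := (Cplx R).
Local Notation q := (@square_map R N M).
Local Notation glued := (clos_refl_sym_trans _ (@side_glued R N M)).

(** The developing map turns square [f] by [- th f] right angles. *)
Definition square_dir (f : 'I_N) : C := 'i ^+ (- th f : 'Z_4)%R.

(** The direction of side [d.2] of square [d.1] under the developing map. *)
Definition dart_dir (d : dart N) : C := square_dir d.1 * 'i ^+ d.2.

Lemma mag_square_dir f : mag (square_dir f) = 1.
Proof. exact: mag_iX. Qed.

Lemma dart_dirE d : dart_dir d = 'i ^+ (d.2 - th d.1)%R.
Proof. by rewrite /dart_dir /square_dir -expr_iD addrC. Qed.

Lemma mag_dart_dir d : mag (dart_dir d) = 1.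
Proof. by rewrite dart_dirE mag_iX. Qed.

Lemma dart_dir_neq0 d : dart_dir d != 0.
Proof. by rewrite -mag_eq0 mag_dart_dir oner_eq0. Qed.

(** Glued sides become opposite vectors, so gluing is by translations. *)
Lemma dart_dir_glue d : dart_dir (M d) = - dart_dir d.
Proof.
have shuffle (V : comNzRingType) (t s r h k : V) :
    t - s + r = h - k -> t - h = s - k - r.
  move=> E; have -> : t = h - k - r + s by rewrite -E; ring.
  ring.
have := rotationE d; rewrite /rotation => /shuffle E.
rewrite !dart_dirE E -[RHS]mulrN1 -[X in _ * X]sqrCi.
exact: (expr_iD R _ (- 2)%R).
Qed.

Lemma dart_dir_face_rot_inv d : dart_dir (face_rot_inv d) = - 'i * dart_dir d.
Proof.
have E : (face_rot_inv d).2 - th (face_rot_inv d).1 = -1 + (d.2 - th d.1).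
  exact: etrans (addrAC _ _ _) (addrC _ _).
rewrite !dart_dirE E; apply: etrans (expr_iD R (-1) _) _; congr (_ * _).
by rewrite -[RHS]mulrN1 -[X in _ * X]sqrCi -exprS.
Qed.

(** Consecutive sides around a vertex differ by a right angle. *)
Lemma dart_dir_vertex_perm d : dart_dir (vertex_perm M d) = 'i * dart_dir d.
Proof. by rewrite dart_dir_glue dart_dir_face_rot_inv mulNr opprK. Qed.

(** ** Charts inside the squares *)

Lemma continuous_scale_shift (a c z : C) : {for z, continuous (fun z => a * (z - c))}.
Proof.
have c1 : {for z, continuous (fun z : C => z)} by exact: cvg_id.
have c2 : {for z, continuous (fun _ : C => c)} by exact: cst_continuous.
have c3 : {for z, continuous (fun _ : C => a)} by exact: cst_continuous.
exact: (continuousM c3 (continuousB c1 c2)).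
Qed.

Lemma square_dir_neq0 h : square_dir h != 0.
Proof. by rewrite -mag_eq0 mag_square_dir oner_eq0. Qed.

Section FaceChart.
Variable f : 'I_N.

Let F (p : unit) (z : C) : C := square_dir f * (z - ctr R).
Let inF (p : unit) (z : C) : Prop := unit_square z /\ mag (z - ctr R) < 1 / 2.

Lemma face_mapX p z : inF p z -> F p z ^+ 1 = square_dir f * (z - ctr R).
Proof. by rewrite expr1. Qed.

Lemma face_map_inj p p' z z' : inF p z -> inF p' z' -> F p z = F p' z' ->
  glued (f, z) (f, z').
Proof. by move=> _ _ /(mulfI (square_dir_neq0 f))/addIr ->; apply: rst_refl. Qed.

(** The disc does not reach the sides. *)
Lemma face_map_glue (p : unit) (d : dart N) x : 0 <= x <= 1 -> f = d.1 ->
  inF p (side_point d.2 (rC x)) ->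
  exists p', [/\ f = (M d).1, inF p' (side_point (M d).2 (rC (1 - x))) &
    F p' (side_point (M d).2 (rC (1 - x))) = F p (side_point d.2 (rC x))].
Proof. by move=> _ _ [_]; rewrite ltNge side_center_far. Qed.

Lemma small_in_square (a : C) : mag a < 1 / 2 -> unit_square (ctr R + a).
Proof.
move=> h; have := mag_ge_re a; have := mag_ge_im a.
rewrite !ler_norml => /andP[? ?] /andP[? ?].
by apply/unit_squareE; rewrite !planeE; split; lra.
Qed.

Lemma face_map_surj w : mag w ^+ 1 < 1 / 2 -> exists p z, inF p z /\ F p z = w.
Proof.
rewrite expr1 => h; exists tt, (ctr R + w / square_dir f).
have E : ctr R + w / square_dir f - ctr R = w / square_dir f by rewrite addrAC subrr add0r.
have hw : mag (w / square_dir f) < 1 / 2.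
  have := magM (w / square_dir f) (square_dir f).
  by rewrite mulfVK ?square_dir_neq0 // mag_square_dir mulr1 => <-.
split; first by split; [exact: small_in_square | rewrite E].
by rewrite /F E mulrC mulfVK // square_dir_neq0.
Qed.

Definition face_chart : petal_chart M square_dir := {|
  petal := unit; petal_square := fun=> f; petal_ctr := fun=> ctr R;
  petal_rad := 1 / 2; petal_deg := 1%N; petal_map := F;
  petal_deg_gt0 := isT;
  petal_disjoint := fun p p' z _ _ _ => match p, p' with tt, tt => erefl end;
  petal_mapX := face_mapX;
  petal_map_cont := fun p z _ => @continuous_scale_shift (square_dir f) (ctr R) z;
  petal_map_inj := face_map_inj;
  petal_map_glue := face_map_glue;
  petal_map_surj := face_map_surj |}.

End FaceChart.

(** ** Charts across the edges *)

Section EdgeChart.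
Variable d : dart N.

Let e (p : bool) : dart N := if p then d else M d.
Let mid (p : bool) : C := side_point (e p).2 (rC (1 / 2)).
Let F (p : bool) (z : C) : C := square_dir (e p).1 * (z - mid p).
Let inF (p : bool) (z : C) : Prop := unit_square z /\ mag (z - mid p) < 1 / 4.

Let glue_e p : M (e p) = e (~~ p).
Proof. by case: p; rewrite /e //= glueK. Qed.

Let e_inj : injective e.
Proof.
have /eqP ne := glue_neq M d.
by move=> [] [] // E; case: ne.
Qed.

Let FE p u : F p (side_point (e p).2 u) = dart_dir (e p) * (u - rC (1 / 2)).
Proof. by rewrite /F /mid side_pointB mulrA. Qed.

Let inFE p u : inF p (side_point (e p).2 u) <->
  unit_square u /\ mag (u - rC (1 / 2)) < 1 / 4.
Proof.
rewrite /inF /mid mag_side_pointB.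
by split=> -[h ?]; split=> //; move: h => /unit_square_sideE.
Qed.

Let dir_e p p' : p != p' -> dart_dir (e p') = - dart_dir (e p).
Proof. by case: p p' => [] [] // _; rewrite /e /= dart_dir_glue ?opprK. Qed.

Lemma edge_disjoint p p' z : (e p).1 = (e p').1 -> inF p z -> inF p' z -> p = p'.
Proof.
move=> E1 [_ h] [_ h']; apply: e_inj.
have E2 := mid_disjoint h h'.
by rewrite [LHS]surjective_pairing [RHS]surjective_pairing E1 E2.
Qed.

Lemma edge_mapX p z : inF p z -> F p z ^+ 1 = square_dir (e p).1 * (z - mid p).
Proof. by rewrite expr1. Qed.

(** The two half discs lie on opposite sides of the edge, so points of different
    petals with the same coordinate are on the edge. *)
Lemma edge_map_inj p p' z z' : inF p z -> inF p' z' -> F p z = F p' z' ->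
  glued ((e p).1, z) ((e p').1, z').
Proof.
rewrite -(side_pointNK (e p).2 z) -(side_pointNK (e p').2 z').
move: (side_point (- (e p).2) z) (side_point (- (e p').2) z') => u u'.
move=> /inFE[hu _] /inFE[hu' _]; rewrite !FE.
have [<-|pp'] := eqVneq p p'.
  by move=> /(mulfI (dart_dir_neq0 _))/addIr ->; apply: rst_refl.
rewrite (dir_e pp') mulNr -mulrN => /(mulfI (dart_dir_neq0 _)) E.
have {E}E : u' = 1 - u.
  apply/eqP; rewrite -subr_eq0; apply/eqP.
  have h : rC (1 / 2) + rC (1 / 2) = 1 :> C by rewrite -rCD -rC1; congr rC; lra.
  have -> : u' - (1 - u) = (u - rC (1 / 2)) - (- (u' - rC (1 / 2))) +
     (rC (1 / 2) + rC (1 / 2) - 1) by ring.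
  by rewrite E h !subrr addr0.
move: hu hu' => /unit_squareE[a1 a2 a3 a4] /unit_squareE.
rewrite E !reimE => -[b1 b2 b3 b4].
have -> : u = rC (re u) by apply: plane_eq; rewrite ?im_rC //; lra.
have -> : e p' = M (e p) by rewrite glue_e; case: p p' pp' => [] [].
apply: rst_step; apply: SideGlued.
by rewrite -rC0 -rC1 !ler_rC a1 a2.
Qed.

Lemma edge_map_glue p (b : dart N) x : 0 <= x <= 1 -> (e p).1 = b.1 ->
  inF p (side_point b.2 (rC x)) ->
  exists p', [/\ (e p').1 = (M b).1, inF p' (side_point (M b).2 (rC (1 - x))) &
    F p' (side_point (M b).2 (rC (1 - x))) = F p (side_point b.2 (rC x))].
Proof.
move=> xI E1 inp; have E2 := side_mid_near xI inp.2.
have {E1 E2}E : b = e p.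
  by rewrite [LHS]surjective_pairing [RHS]surjective_pairing E1 E2.
subst b; exists (~~ p); rewrite !glue_e; split=> //.
  apply/inFE; move/inFE: inp => [_ h]; split.
    by apply: unit_square_real; move/andP: xI => [? ?]; lra.
  move: h; rewrite -!rCN -!rCD !mag_rC => h.
  by rewrite (_ : 1 - x - 1 / 2 = - (x - 1 / 2)) ?normrN //; lra.
rewrite !FE (@dir_e p (~~ p)); last by case: (p).
by rewrite mulNr -mulrN -!rCN -!rCD -rCN; congr (_ * rC _); lra.
Qed.

(** The sign of the imaginary part decides which half disc contains the point. *)
Lemma edge_map_surj w : mag w ^+ 1 < 1 / 4 -> exists p z, inF p z /\ F p z = w.
Proof.
rewrite expr1 => h.
have key p (a : C) : dart_dir (e p) * a = w -> 0 <= im a ->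
    exists p z, inF p z /\ F p z = w.
  move=> E a0; exists p, (side_point (e p).2 (rC (1 / 2) + a)).
  have ma : mag a < 1 / 4.
    by have := magM (dart_dir (e p)) a; rewrite E mag_dart_dir mul1r => <-.
  have aE : rC (1 / 2) + a - rC (1 / 2) = a by rewrite addrAC subrr add0r.
  split; last by rewrite FE aE.
  apply/inFE; rewrite aE; split=> //.
  have := mag_ge_re a; have := mag_ge_im a; rewrite !ler_norml => /andP[? ?] /andP[? ?].
  by apply/unit_squareE; rewrite !reimE; split; lra.
pose a := w / dart_dir d.
have aE : dart_dir d * a = w by rewrite /a mulrC mulfVK // dart_dir_neq0.
have [a0|a0] := leP 0 (im a); first exact: (key true a).
apply: (key false (- a)); last by rewrite imN; lra.
by rewrite /e dart_dir_glue mulrNN.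
Qed.

Definition edge_chart : petal_chart M square_dir := {|
  petal := bool; petal_square := fun p => (e p).1; petal_ctr := mid;
  petal_rad := 1 / 4; petal_deg := 1%N; petal_map := F;
  petal_deg_gt0 := isT;
  petal_disjoint := edge_disjoint;
  petal_mapX := edge_mapX;
  petal_map_cont := fun p z _ => @continuous_scale_shift (square_dir (e p).1) (mid p) z;
  petal_map_inj := edge_map_inj;
  petal_map_glue := edge_map_glue;
  petal_map_surj := edge_map_surj |}.

End EdgeChart.

(** ** The chart at the vertex *)

Lemma squares_gt0 : (0 < N)%N.
Proof. exact: leq_ltn_trans (ltn_ord d0.1). Qed.

(** The darts in the order in which their corners follow each other around the
    vertex. *)
Definition turn_dart (k : nat) : dart N := iter k (vertex_perm M) d0.

Lemma turn_dart_next k : turn_dart k.+1 = M (face_rot_inv (turn_dart k)).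
Proof. by []. Qed.

Lemma order_d0 : order (vertex_perm M) d0 = (4 * N)%N.
Proof.
rewrite /order (eq_card (B := dart N)) ?card_dart // => d.
by rewrite inE; exact: one_orbit.
Qed.

Lemma turn_dart_mod k : (k <= 4 * N)%N -> turn_dart (k %% (4 * N)) = turn_dart k.
Proof.
rewrite leq_eqVlt => /predU1P[->|kN]; last by rewrite modn_small.
by rewrite modnn -order_d0 /turn_dart iter_order //; apply: vertex_perm_inj.
Qed.

Lemma turn_dart_onto d : exists2 k, (k < 4 * N)%N & turn_dart k = d.
Proof.
have := one_orbit d0 d; rewrite fconnect_orbit => /trajectP[k].
by rewrite order_d0 => kN ->; exists k.
Qed.

Lemma turn_dart_inj k k' : (k < 4 * N)%N -> (k' < 4 * N)%N ->
  turn_dart k = turn_dart k' -> k = k'.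
Proof.
rewrite -order_d0 => kN kN' E.
have := orbit_uniq (vertex_perm M) d0.
move/uniqP => /(_ d0 k k'); rewrite !inE size_traject => /(_ kN kN').
by rewrite !nth_traject //; apply.
Qed.

Lemma dart_dir_turn k : dart_dir (turn_dart k) = 'i ^+ k.
Proof.
elim: k => [|k IH]; first by rewrite dart_dirE d0_turn subrr expr0.
by rewrite exprS -IH -dart_dir_vertex_perm.
Qed.

Local Notation corner d := (side_point d.2 (0 : C)).

(** All corners of squares are the same point of the surface, because turning
    around the vertex passes through all darts. *)
Lemma corner_next k :
  glued ((turn_dart k).1, corner (turn_dart k)) ((turn_dart k.+1).1, corner (turn_dart k.+1)).
Proof.
apply: rst_step; rewrite turn_dart_next.
have := @SideGlued R N M (face_rot_inv (turn_dart k)) 1.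
rewrite subrr lexx ler01 => /(_ isT).
have -> // : side_point (face_rot_inv (turn_dart k)).2 (1 : C) = corner (turn_dart k).
have E : side_point (-1) (1 : C) = 0.
  rewrite (_ : -1 = 3); last exact: val_inj.
  by apply: plane_eq; rewrite side3 side2 ?sideE; lra.
by rewrite -E -side_pointD.
Qed.

Lemma corners_glued (d d' : dart N) : glued (d.1, corner d) (d'.1, corner d').
Proof.
suff H e : glued (d0.1, corner d0) (e.1, corner e).
  by apply: rst_trans (H d'); apply: rst_sym.
have [k _ <-] := turn_dart_onto e.
elim: k => [|k IH]; first exact: rst_refl.
exact: rst_trans IH (corner_next k).
Qed.

Section VertexChart.

Let e (k : 'I_(4 * N)) : dart N := turn_dart k.
Let ctr_e (k : 'I_(4 * N)) : C := corner (e k).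
Let local (k : 'I_(4 * N)) (z : C) : C := side_point (- (e k).2) z.
Let F (k : 'I_(4 * N)) (z : C) : C := root_petal N k (local k z).
Let inF (k : 'I_(4 * N)) (z : C) : Prop := unit_square z /\ mag (z - ctr_e k) < 1 / 2.

Let inFE k u : inF k (side_point (e k).2 u) <-> unit_square u /\ mag u < 1 / 2.
Proof.
rewrite /inF /ctr_e mag_side_pointB subr0.
by split=> -[h ?]; split=> //; move: h => /unit_square_sideE.
Qed.

Let FE k u : F k (side_point (e k).2 u) = root_petal N k u.
Proof. by rewrite /F /local side_pointK. Qed.

Let square_quadrant (u : C) : unit_square u -> quadrant u.
Proof. by move=> /unit_squareE[? _ ? _]. Qed.

Let succ (k : 'I_(4 * N)) : 'I_(4 * N) := ordS k.

Let e_succ k : e (succ k) = M (face_rot_inv (e k)).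
Proof. by rewrite /e /= turn_dart_mod ?turn_dart_next. Qed.

Let succ_petal k (x : R) :
  root_petal N (succ k) (rC x : C) = root_petal N k.+1 (rC x).
Proof.
have : (k.+1 <= 4 * N)%N by [].
rewrite /= leq_eqVlt => /predU1P[E|kN]; last by rewrite modn_small.
by rewrite E modnn root_petal_period // squares_gt0.
Qed.

(** The side before [e k] ends at the corner where [e k] starts; in the coordinate
    of petal [k] it runs down the imaginary axis. *)
Let side_before k (t : C) :
  side_point (face_rot_inv (e k)).2 (1 - t) = side_point (e k).2 ('i * t).
Proof.
have E : side_point (-1) (1 - t) = 'i * t.
  rewrite (_ : -1 = 3); last exact: val_inj.
  by apply: plane_eq; rewrite side3 side2 ?sideE; lra.
by rewrite -E -side_pointD.
Qed.

Lemma vertex_disjoint k k' z : (e k).1 = (e k').1 -> inF k z -> inF k' z -> k = k'.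
Proof.
move=> E1 [_ h] [_ h']; apply: val_inj; apply: (turn_dart_inj (ltn_ord k) (ltn_ord k')).
have E2 := corner_disjoint h h'.
rewrite -/(e k) -/(e k').
by rewrite [LHS]surjective_pairing [RHS]surjective_pairing E1 E2.
Qed.

Lemma vertex_mapX k z : inF k z -> F k z ^+ N = square_dir (e k).1 * (z - ctr_e k).
Proof.
rewrite -(side_pointNK (e k).2 z); move: (side_point (- (e k).2) z) => u.
move=> /inFE[hu _]; rewrite FE root_petalX ?squares_gt0 //; last exact: square_quadrant.
rewrite /ctr_e side_pointB subr0 mulrA; congr (_ * _).
exact: esym (dart_dir_turn k).
Qed.

Lemma vertex_map_cont k z : inF k z -> {for z, continuous (F k)}.
Proof.
move=> [hz _]; apply: (@continuous_comp _ _ _ (local k) (root_petal N k)).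
  have c1 : {for z, continuous (fun z : C => z - ctr R)}.
    have c1 : {for z, continuous (fun z : C => z)} by exact: cvg_id.
    have c2 : {for z, continuous (fun _ : C => ctr R)} by exact: cst_continuous.
    exact: (continuousB c1 c2).
  have c2 : {for z, continuous (fun _ : C => ctr R)} by exact: cst_continuous.
  have c3 : {for z, continuous (fun _ : C => 'i ^+ (- (e k).2)%R : C)} by exact: cst_continuous.
  exact: (continuousD c2 (continuousM c3 c1)).
apply: continuous_root_petal; first exact: squares_gt0.
by apply: square_quadrant; apply: unit_square_side.
Qed.

Let glued_next k (t : R) : 0 <= t <= 1 ->
  glued ((e k).1, side_point (e k).2 ('i * rC t)) ((e (succ k)).1, side_point (e (succ k)).2 (rC t)).
Proof.
move=> /andP[t0 t1]; apply: rst_step.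
have := @SideGlued R N M (face_rot_inv (e k)) (1 - rC t).
rewrite side_before subKr -e_succ; apply.
by rewrite subr_ge0 lerBlDr lerDl -rC0 -rC1 !ler_rC t0 t1.
Qed.

Lemma vertex_map_inj k k' z z' : inF k z -> inF k' z' -> F k z = F k' z' ->
  glued ((e k).1, z) ((e k').1, z').
Proof.
rewrite -(side_pointNK (e k).2 z) -(side_pointNK (e k').2 z').
move: (side_point (- (e k).2) z) (side_point (- (e k').2) z') => u u'.
move=> /inFE[hu mu] /inFE[hu' mu']; rewrite !FE => E.
have := root_petal_inj squares_gt0 (ltn_ord k) (ltn_ord k')
  (square_quadrant hu) (square_quadrant hu') E.
have small t : 0 <= t -> mag (rC t : C) < 1 / 2 -> 0 <= t <= 1.
  by move=> t0; rewrite mag_rC ger0_norm // => h; lra.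
case=> [-> ->|kk ->|t t0 -> u'E kk|t t0 uE -> kk].
- exact: corners_glued.
- by rewrite (val_inj kk : k = k'); apply: rst_refl.
- have -> : k' = succ k by exact: val_inj.
  by rewrite u'E; apply: glued_next; apply: small => //; rewrite -u'E.
- have -> : k = succ k' by exact: val_inj.
  by rewrite uE; apply: rst_sym; apply: glued_next; apply: small => //; rewrite -uE.
Qed.

Lemma vertex_map_glue k (b : dart N) x : 0 <= x <= 1 -> (e k).1 = b.1 ->
  inF k (side_point b.2 (rC x)) ->
  exists k', [/\ (e k').1 = (M b).1, inF k' (side_point (M b).2 (rC (1 - x))) &
    F k' (side_point (M b).2 (rC (1 - x))) = F k (side_point b.2 (rC x))].
Proof.
move=> xI E1 inp; have [] := side_corner_near xI inp.2 => -[E2 x2].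
  (* the side leaves the vertex: its partner is in the previous petal *)
  have bE : b = e k.
    by rewrite [LHS]surjective_pairing [RHS]surjective_pairing E1 E2.
  subst b; pose k' := ord_pred k.
  have kE : k = succ k' by rewrite /succ /k' ord_predK.
  have eE : M (e k) = face_rot_inv (e k') by rewrite kE e_succ glueK.
  exists k'; rewrite eE rCD rC1 rCN side_before; split=> //.
    apply/inFE; rewrite magM mag_i mul1r mag_rC.
    move/andP: xI => [x0 x1]; split; last by rewrite ger0_norm.
    by apply/unit_squareE; rewrite !reimE; split; lra.
  rewrite !FE [in RHS]kE succ_petal root_petal_next ?squares_gt0 //.
  by case/andP: xI.
(* the side arrives at the vertex: its partner is in the next petal *)
have bE : b = face_rot_inv (e k).
  by rewrite [LHS]surjective_pairing [RHS]surjective_pairing /= E1 -E2.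
subst b; exists (succ k); rewrite -e_succ; split=> //.
  apply/inFE; move/andP: xI => [x0 x1]; split.
    by apply: unit_square_real; lra.
  by rewrite mag_rC ger0_norm //; lra.
have -> : side_point (face_rot_inv (e k)).2 (rC x) = side_point (e k).2 ('i * rC (1 - x)).
  by rewrite -side_before -rC1 -rCN -rCD; congr (side_point _ (rC _)); lra.
rewrite !FE succ_petal root_petal_next ?squares_gt0 //.
by case/andP: xI => ? ?; lra.
Qed.

Lemma vertex_map_surj w : mag w ^+ N < 1 / 2 -> exists k z, inF k z /\ F k z = w.
Proof.
move=> h; have [k [u [kN qu Fu]]] := root_petal_surj squares_gt0 w.
have mu : mag u < 1 / 2.
  move: h; rewrite -Fu mag_root_petal root_powR ?squares_gt0 //; exact: mag_ge0.
exists (Ordinal kN), (side_point (e (Ordinal kN)).2 u); rewrite FE; split=> //.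
apply/inFE; split=> //; case: qu => u0 u1.
have := mag_ge_re u; have := mag_ge_im u; rewrite !ler_norml => /andP[? ?] /andP[? ?].
by apply/unit_squareE; split=> //; lra.
Qed.

Definition vertex_chart : petal_chart M square_dir := {|
  petal := 'I_(4 * N); petal_square := fun k => (e k).1; petal_ctr := ctr_e;
  petal_rad := 1 / 2; petal_deg := N; petal_map := F;
  petal_deg_gt0 := squares_gt0;
  petal_disjoint := vertex_disjoint;
  petal_mapX := vertex_mapX;
  petal_map_cont := vertex_map_cont;
  petal_map_inj := vertex_map_inj;
  petal_map_glue := vertex_map_glue;
  petal_map_surj := vertex_map_surj |}.

End VertexChart.

(** ** The atlas *)

Variant chart_place := AtSquare of 'I_N | AtEdge of dart N | AtVertex.

Definition place_chart (c : chart_place) : petal_chart M square_dir :=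
  match c with
  | AtSquare f => face_chart f
  | AtEdge d => edge_chart d
  | AtVertex => vertex_chart
  end.

Definition vertex_point : surface R M := q d0.1 (corner d0).

Lemma unit_square0 : unit_square (0 : C).
Proof. by rewrite -rC0; apply: unit_square_real; rewrite lexx ler01. Qed.

Lemma unit_square_corner (d : dart N) : unit_square (corner d : C).
Proof. exact: unit_square_side unit_square0. Qed.

Lemma corner_vertex (d : dart N) : q d.1 (corner d) = vertex_point.
Proof. by apply/square_mapP; [exact: unit_square_corner..|exact: corners_glued]. Qed.

(** The discs around centres, midpoints and corners cover the square. *)
Lemma place_covered x : exists c, petal_dom (place_chart c) x.
Proof.
have [f [z [hz <-]]] := square_map_onto x.
have [h|[s h]|[s h]] := square_covered hz.
- by exists (AtSquare f), (square_dir f * (z - ctr R)), (tt : petal (face_chart f)), z.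
- exists (AtEdge (f, s)), (square_dir f * (z - side_point s (rC (1 / 2)))).
  by exists (true : petal (edge_chart (f, s))), z.
- have [k kN kE] := turn_dart_onto (f, s).
  have inz : @in_petal _ _ _ _ vertex_chart (Ordinal kN) z by split=> //=; rewrite kE.
  exists AtVertex; exists (@petal_map _ _ _ _ vertex_chart (Ordinal kN) z).
  by have := coord_petal inz; rewrite /= kE.
Qed.

Lemma place_connected : connected [set: surface R M].
Proof.
apply: (@surface_connected R N M vertex_point) => f.
by rewrite -(corner_vertex (f, 0)) /= side_point0.
Qed.

Lemma vertex_coord0 : coord vertex_chart vertex_point 0.
Proof.
have k0 : (0 < 4 * N)%N by rewrite muln_gt0 squares_gt0.
exists (Ordinal k0), (corner d0); split=> //.
  split; first exact: unit_square_corner.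
  by rewrite /= subrr -[0]rC0 mag_rC normr0; lra.
by rewrite /= side_pointK root_petal0 // squares_gt0.
Qed.

Lemma vertex_isolated c : petal_dom (place_chart c) vertex_point -> c = AtVertex.
Proof.
case: c => [f|d|//] [w /coord_square-/(_ (unit_square_corner d0))[p [_ [_ h] _]]].
  by move: h; rewrite /= ltNge corner_center_far.
by move: h; rewrite /= ltNge corner_mid_far.
Qed.

Lemma place_branch i j x : petal_deg (place_chart j) <> 1%N ->
  coord (place_chart j) x 0 -> petal_dom (place_chart i) x -> i = j.
Proof.
case: j => [//|//|] _ cx.
have -> : x = vertex_point by exact: coord_inj cx vertex_coord0.
exact: vertex_isolated.
Qed.

Lemma place_branch_boundary i (p : petal (place_chart i)) :
  petal_deg (place_chart i) <> 1%N -> ~ open_unit_square (petal_ctr p).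
Proof.
case: i p => [//|//|] k _ /=; move: (turn_dart k).2 => s /open_unit_squareE.
by elim/side_ind: s; rewrite ?side3 ?side2 ?side_point0 ?sideE => -[*]; lra.
Qed.

Lemma translation_surface : (1 < N)%N ->
  exists (S : compact_riemann_surface R) (w : holomorphic_form S) (q : 'I_N -> C -> S),
    [/\ mesh_realization M q, squares_flat w q & single_zero_of_order w N.-1].
Proof.
move=> N1.
exists (petal_surface mag_square_dir vertex_point place_covered place_connected place_branch).
exists (petal_form mag_square_dir vertex_point place_covered place_connected place_branch).
exists q; split.
- exact: petal_surface_realization.
- apply: petal_form_flat => [f|]; first by exists (nat_of_ord (- th f)).
  exact: place_branch_boundary.
- apply: (@petal_form_single_zero _ _ _ _ _ _ _ _ _ _ _ AtVertex vertex_point) => /=.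
  + by move/eqP; rewrite gtn_eqF.
  + by case.
  + exact: vertex_coord0.
Qed.

End TranslationMesh.

Theorem lemma4p3 (R : realType) (g : nat) (hg : (2 <= g)%N) :
  (exists M : quad_mesh (2 * g - 1),
     [/\ glued_by (pairs_full g) M,
         mesh_genus M g,
         exists v, vertices M = [set v]%SET /\ #|v| = (8 * g - 4)%N &
         holonomy_image M = [set: 'Z_4]%classic])
  /\
  (exists M : quad_mesh (2 * g - 1),
     [/\ glued_by (pairs_trivial g) M,
         mesh_genus M g,
         exists v, vertices M = [set v]%SET,
         holonomy_image M = [set 0%R]%classic &
         in_minimal_stratum R M g]).
Proof.
have N0 : (0 < 4 * (2 * g - 1))%N by lia.
pose d0 := dart_of N0.
split.
  exists (twist_mesh hg); have genus := one_vertex_genus d0 (twist_connected hg) (twist_one_orbit hg).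
  split=> //.
  - exact: twist_glued.
  - exists [set: dart (2 * g - 1)]%SET; split; first exact: one_vertex (twist_one_orbit hg) d0.
    by rewrite cardsT card_dart; lia.
  - exact: twist_holonomy.
exists (stair_mesh hg).
have genus := one_vertex_genus d0 (stair_connected hg) (stair_one_orbit hg).
have d0_turn : stair_turn d0.1 = d0.2 by exact: val_inj.
split=> //.
- exact: stair_glued.
- by exists [set: dart (2 * g - 1)]%SET; apply: one_vertex (stair_one_orbit hg) d0.
- exact: trivial_holonomy (stair_rotation hg).
- split=> //; have [|S [w [q H]]] := translation_surface R (stair_rotation hg) (stair_one_orbit hg) d0_turn.
    by lia.
  exists S, w, q; rewrite (_ : (2 * g - 2)%N = (2 * g - 1).-1) //; lia.
Qed.
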